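(* Let $(\mathfrak{g},\delta)$ be a topological involutive Lie bialgebra and $(M,\mu)$ a topological involutive right $\mathfrak{g}$-bimodule. Let $X\in\mathfrak{g}$ and suppose that $e^{\operatorname{ad}X}=\sum_{k=0}^\infty\frac{1}{k!}(\operatorname{ad}(X))^k$ and $e^{\sigma(X)}=\sum_{k=0}^\infty\frac{1}{k!}(\sigma(X))^k$ converge as automorphisms of the topological Lie algebra $\mathfrak{g}$ and of the topological vector space $M$, respectively. Then $$d(\delta,\mu)=d(e^{\operatorname{ad}X}\delta,\,e^{\sigma(X)}\mu)\quad\text{on } H_*(\mathfrak{g};M).$$
   Context: All vector spaces are over $\mathbb{Q}$. ''Topological'' is understood in the following sense: $\mathfrak{g}$ (and likewise $M$) carries a decreasing filtration $\mathfrak{g}=F_0\mathfrak{g}\supset F_1\mathfrak{g}\supset\cdots$ for which $\mathfrak{g}\to\varprojlim_n\mathfrak{g}/F_n\mathfrak{g}$ is an isomorphism; structure maps are continuous; and all tensor products $\otimes$, tensor powers and exterior powers $\Lambda^p$ below are the completed ones (the completed exterior power being the alternating part of the completed tensor power); identities given on decomposable elements are extended linearly and continuously. $X_1\wedge\cdots\wedge X_p:=\sum_{s\in\mathfrak{S}_p}(\operatorname{sgn}s)\,X_{s(1)}\otimes\cdots\otimes X_{s(p)}$, the wedge product is determined by $(X_1\wedge\cdots\wedge X_p)\wedge(X_{p+1}\wedge\cdots\wedge X_{p+q})=X_1\wedge\cdots\wedge X_{p+q}$, and $(m\otimes\xi)\wedge\eta:=m\otimes(\xi\wedge\eta)$.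 $T$ is the flip on $\mathfrak{g}^{\otimes2}$, $N:=1+(123)+(123)^2$ on $\mathfrak{g}^{\otimes3}$, hats over elements denote omission. With bracket $\nabla$, $[X,Y]=\nabla(X\otimes Y)$: $\sigma(Y)(X_1\wedge\cdots\wedge X_p):=\sum_iX_1\wedge\cdots\wedge[Y,X_i]\wedge\cdots\wedge X_p$; $\partial(X_1\wedge\cdots\wedge X_p):=\sum_{i<j}(-1)^{i+j}[X_i,X_j]\wedge X_1\wedge\cdots\widehat{X_i}\cdots\widehat{X_j}\cdots\wedge X_p$; $d|_{\Lambda^0\mathfrak{g}}:=0$, $d(X_1\wedge\cdots\wedge X_p):=\sum_i(-1)^i(\delta X_i)\wedge X_1\wedge\cdots\widehat{X_i}\cdots\wedge X_p$. $(\mathfrak{g},\delta)$ is an involutive Lie bialgebra if $\mathfrak g$ is a Lie algebra, $\delta:\mathfrak{g}\to\Lambda^2\mathfrak{g}$ satisfies $N(\delta\otimes1)\delta=0$, $\delta[X,Y]=\sigma(X)(\delta Y)-\sigma(Y)(\delta X)$ for all $X,Y$, and $\nabla\delta=0$. For a left $\mathfrak{g}$-module $M$ and $\mu:M\to M\otimes\mathfrak{g}$: $\sigma(Y)m:=Ym$ and $\overline{\sigma}(m\otimes Y):=-Ym$; $\sigma(Y)(m\otimes\xi):=(Ym)\otimes\xi+m\otimes\sigma(Y)\xi$; $\partial^M(m\otimes\xi):=\Gamma(m\otimes\xi)+m\otimes\partial\xi$ with $\Gamma(m\otimes X_1\wedge\cdots\wedge X_p):=\sum_i(-1)^i(X_im)\otimes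 X_1\wedge\cdots\widehat{X_i}\cdots\wedge X_p$; $d^M(m\otimes\xi):=\mu(m)\wedge\xi+m\otimes d\xi$. $(M,\mu)$ is an involutive right $\mathfrak{g}$-bimodule if $(1_M\otimes\delta)\mu=(1_M\otimes(1-T))(\mu\otimes1_{\mathfrak{g}})\mu$, $\sigma(Y)(\mu(m))-\mu(Ym)-(\overline{\sigma}\otimes1_{\mathfrak{g}})(1_M\otimes\delta)(m\otimes Y)=0$ for all $m,Y$, and $\overline{\sigma}\mu=0$. Then $d^Md^M=0$ and $d^M\partial^M+\partial^Md^M=0$; $H_*(\mathfrak{g};M)$ is the homology of $(M\otimes\Lambda^*\mathfrak{g},\partial^M)$ and $d(\delta,\mu):H_p(\mathfrak{g};M)\to H_{p+1}(\mathfrak{g};M)$ is $[u]\mapsto[d^Mu]$. For an automorphism $U$ of the topological Lie algebra $\mathfrak{g}$ and an automorphism $U^M$ of the topological vector space $M$ compatible with $U$ (that is, $U^M(Ym)=U(Y)U^M(m)$), set $U\delta:=(U\otimes U)\delta U^{-1}$ and $U\mu:=(U^M\otimes U)\mu(U^M)^{-1}$; then $(\mathfrak{g},U\delta)$ is an involutive Lie bialgebra and $(M,U\mu)$ an involutive right $(\mathfrak{g},U\delta)$-bimodule. In the claim $e^{\operatorname{ad}X}\delta$ and $e^{\sigma(X)}\mu$ denote $U\delta$ and $U\mu$ for $U=e^{\operatorname{ad}X}$, $U^M=e^{\sigma(X)}$. *)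

(* Defs.v *)
From HB Require Import structures.
From mathcomp Require Import all_boot all_order all_fingroup all_algebra.
From mathcomp Require Import zify generic_quotient ring_quotient.
From mathcomp Require Import boolp classical_sets functions.
From mathcomp.multinomials Require Import freeg.

Set Implicit Arguments.
Unset Strict Implicit.
Unset Printing Implicit Defensive.

Import GRing.Theory.

Local Open Scope ring_scope.
Local Open Scope classical_set_scope.
Local Open Scope quotient_scope.

Record filtration (E : lmodType rat) := Filtration {
  level :> nat -> set E;
  level_full : level 0%N = setT;
  level_decr : forall n, level n.+1 `<=` level n;
  level0 : forall n, level n 0;
  level_lin : forall n a x y, level n x -> level n y -> level n (a *: x + y) }.

(* [fil_sep] and [fil_complete] are injectivity and surjectivity of the map
   V -> lim_n V / fil n. *)
HB.mixin Record hasCompleteFiltration V of GRing.Lmodule rat V := {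
  fil : filtration V;
  fil_sep : forall x : V, (forall n, fil n x) -> x = 0;
  fil_complete : forall x : nat -> V, (forall n, fil n (x n.+1 - x n)) ->
    exists l, forall n, fil n (l - x n) }.

#[short(type="cfiltType")]
HB.structure Definition CFilt :=
  { V of GRing.Lmodule rat V & hasCompleteFiltration V }.

Arguments fil {s}.

Definition converges (V : cfiltType) (x : nat -> V) (l : V) :=
  forall k, exists n0 : nat, forall n, (n0 <= n)%N -> fil k (x n - l).

Definition limit (V : cfiltType) (x : nat -> V) : V := xget 0 (converges x).

Definition continuous_linear (V W : cfiltType) (f : V -> W) :=
  linear f /\ forall n, exists m, forall x, fil m x -> fil n (f x).

Section FiltrationTheory.
Variables (E : lmodType rat) (F : filtration E).

Lemma levelD n x y : F n x -> F n y -> F n (x + y).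
Proof. by move=> Fx Fy; rewrite -[x]scale1r; apply: level_lin. Qed.

Lemma levelZ n a x : F n x -> F n (a *: x).
Proof. by move=> Fx; rewrite -[_ *: _]addr0; apply: level_lin => //; apply: level0. Qed.

Lemma levelB n x y : F n x -> F n y -> F n (x - y).
Proof. by move=> Fx Fy; rewrite -scaleN1r; apply/levelD/levelZ. Qed.

End FiltrationTheory.

(* rat with the discrete topology, used as zeroth tensor power *)
Definition discrete_level (n : nat) : set rat^o := [set x | n = 0%N \/ x = 0].

Lemma discrete_full : discrete_level 0 = setT.
Proof. by apply/seteqP; split=> // x _; left. Qed.

Lemma discrete_decr n : discrete_level n.+1 `<=` discrete_level n.
Proof. by move=> x [//|->]; right. Qed.

Lemma discrete0 n : discrete_level n 0.
Proof. by right. Qed.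

Lemma discrete_lin n (a : rat) x y : discrete_level n x -> discrete_level n y ->
  discrete_level n (a *: x + y).
Proof.
by move=> [->|->]; [left | move=> [->|->]; [left | right; rewrite scaler0 addr0]].
Qed.

Definition discrete_filtration :=
  Filtration discrete_full discrete_decr discrete0 discrete_lin.

Lemma discrete_sep (x : rat^o) : (forall n, discrete_filtration n x) -> x = 0.
Proof. by move=> /(_ 1%N)[]. Qed.

Lemma discrete_complete (x : nat -> rat^o) :
  (forall n, discrete_filtration n (x n.+1 - x n)) ->
  exists l, forall n, discrete_filtration n (l - x n).
Proof.
move=> xC; exists (x 1%N) => -[|n]; first by left.
right; apply/eqP; rewrite subr_eq0; apply/eqP.
elim: n => // n ->; case: (xC n.+1) => // /eqP.
by rewrite subr_eq0 => /eqP.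
Qed.

HB.instance Definition _ :=
  hasCompleteFiltration.Build rat^o discrete_sep discrete_complete.

(* The completion lim_n E / F n, as coherent sequences modulo null sequences *)
Section Completion.
Variables (E : lmodType rat) (F : filtration E).

Definition coherent : {pred nat -> E} :=
  fun u => `[< forall n, F n (u n.+1 - u n) >].

Lemma coherent_closed : submod_closed coherent.
Proof.
split=> [|a u v /asboolP uC /asboolP vC]; apply/asboolP => n.
  by rewrite subrr; apply: level0.
have -> : (a *: u + v) n.+1 - (a *: u + v) n =
          a *: (u n.+1 - u n) + (v n.+1 - v n).
  by rewrite scalerBr !addrfctE !scalrfctE opprD addrACA.
exact: level_lin.
Qed.

HB.instance Definition _ := GRing.isSubmodClosed.Build rat (nat -> E) coherent
  coherent_closed.

Record coherent_seq := CoherentSeq {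
  seq_val :> nat -> E; seq_valP : seq_val \in coherent }.

HB.instance Definition _ := [isSub for seq_val].
HB.instance Definition _ := [Choice of coherent_seq by <:].
HB.instance Definition _ := [SubChoice_isSubLmodule of coherent_seq by <:].

Definition null : {pred coherent_seq} := fun u => `[< forall n, F n (u n) >].

Lemma null_closed : submod_closed null.
Proof.
split=> [|a u v /asboolP uN /asboolP vN]; apply/asboolP => n.
  exact: level0.
exact: level_lin.
Qed.

HB.instance Definition _ := GRing.isSubmodClosed.Build rat coherent_seq null
  null_closed.

Definition completion := Quotient.quot null.

HB.instance Definition _ := GRing.Zmodule.on completion.
HB.instance Definition _ := Quotient.on completion.
HB.instance Definition _ := EqQuotient.on completion.

Lemma pi_completionD : {morph \pi_completion : x y / x + y}.
Proof. exact: Quotient.pi_add. Qed.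

Lemma pi_completion_eq (x y : coherent_seq) :
  (\pi_completion x == \pi_completion y) = (x - y \in null).
Proof. by rewrite Quotient.idealrBE. Qed.

Definition quot_scale (a : rat) := lift_op1 completion ( *:%R a).

Lemma pi_quot_scale a : {morph \pi_completion : x / a *: x >-> quot_scale a x}.
Proof.
move=> x; unlock quot_scale; apply/eqP; rewrite pi_completion_eq -scalerBr.
by apply: rpredZ; rewrite -pi_completion_eq reprK.
Qed.

Lemma quot_scaleA a b x : quot_scale a (quot_scale b x) = quot_scale (a * b) x.
Proof. by rewrite -[x]reprK -!pi_quot_scale scalerA. Qed.

Lemma quot_scale1 : left_id 1 quot_scale.
Proof. by move=> x; rewrite -[x]reprK -pi_quot_scale scale1r. Qed.

Lemma quot_scaleDr : right_distributive quot_scale +%R.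
Proof.
move=> a x y; rewrite -[x]reprK -[y]reprK -!pi_quot_scale -!pi_completionD.
by rewrite -pi_quot_scale scalerDr.
Qed.

Lemma quot_scaleDl x : {morph quot_scale^~ x : a b / a + b}.
Proof.
by move=> a b; rewrite -[x]reprK -!pi_quot_scale scalerDl pi_completionD.
Qed.

HB.instance Definition _ := GRing.Zmodule_isLmodule.Build rat completion
  quot_scaleA quot_scale1 quot_scaleDr quot_scaleDl.

Definition approx (x : completion) (n : nat) : E := seq_val (repr x) n.

Lemma approx_pi (u : coherent_seq) n :
  F n (approx (\pi_completion u) n - u n).
Proof.
have : repr (\pi_completion u) - u \in null.
  by rewrite -pi_completion_eq reprK.
by move/asboolP/(_ n).
Qed.

Lemma approx_coherent x n : F n (approx x n.+1 - approx x n).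
Proof. by rewrite /approx; case: (repr x) => u /= /asboolP. Qed.

Lemma approx_lin a x y n :
  F n (approx (a *: x + y) n - (a *: approx x n + approx y n)).
Proof.
suff -> : a *: x + y = \pi_completion (a *: repr x + repr y) by exact: approx_pi.
by rewrite -{1}[x]reprK -{1}[y]reprK -[_ *: _]pi_quot_scale -pi_completionD.
Qed.

Lemma approxB x y n : F n (approx (x - y) n - (approx x n - approx y n)).
Proof.
by have := approx_lin (-1) y x n; rewrite !scaleN1r ![- _ + _]addrC.
Qed.

Definition completion_level (n : nat) : set completion :=
  [set x | F n (approx x n)].

Lemma completion_full : completion_level 0 = setT.
Proof. by apply/seteqP; split=> // x _; rewrite /completion_level /= level_full. Qed.

Lemma completion_decr n : completion_level n.+1 `<=` completion_level n.
Proof.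
move=> x /level_decr xn; rewrite /completion_level /=.
rewrite -[approx x n](subKr (approx x n.+1)).
exact/levelB/approx_coherent.
Qed.

Lemma completion0 n : completion_level n 0.
Proof.
have <- : \pi_completion 0 = 0 :> completion by rewrite piE.
rewrite /completion_level /= -[approx _ _]subr0; exact: (approx_pi 0).
Qed.

Lemma completion_lin n a x y : completion_level n x -> completion_level n y ->
  completion_level n (a *: x + y).
Proof.
move=> xn yn; rewrite /completion_level /=.
rewrite -[approx _ _](subrK (a *: approx x n + approx y n)).
by apply: levelD; [apply: approx_lin | apply: level_lin].
Qed.

Definition completion_filtration :=
  Filtration completion_full completion_decr completion0 completion_lin.

Lemma completion_sep x : (forall n, completion_filtration n x) -> x = 0.
Proof.
move=> x0; rewrite -[x]reprK.
have -> : 0 = \pi_completion 0 :> completion by rewrite piE.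
by apply/eqP; rewrite pi_completion_eq subr0; apply/asboolP.
Qed.

Lemma completion_complete (x : nat -> completion) :
  (forall n, completion_filtration n (x n.+1 - x n)) ->
  exists l, forall n, completion_filtration n (l - x n).
Proof.
move=> xC; pose u n := approx (x n) n.
have uC : u \in coherent.
  apply/asboolP => n; rewrite /u.
  have h1 := approx_coherent (x n.+1) n.
  have h2 := approxB (x n.+1) (x n) n.
  have := levelB (F := F) (xC n) h2; rewrite subKr => h3.
  by have := levelD h1 h3; rewrite addrA subrK.
exists (\pi_completion (CoherentSeq uC)) => n.
rewrite /completion_filtration /completion_level /=.
rewrite -[approx _ _](subrK (approx (\pi_completion (CoherentSeq uC)) n -
                             approx (x n) n)).
by apply: levelD; [exact: approxB | exact: approx_pi].
Qed.

HB.instance Definition _ :=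
  hasCompleteFiltration.Build completion completion_sep completion_complete.

End Completion.

Inductive linspan (E : lmodType rat) (G : set E) : set E :=
| linspan0 : linspan G 0
| linspan_lin a x y : G x -> linspan G y -> linspan G (a *: x + y).

Section Tensor.
Variables V W : cfiltType.

Local Notation free := {freeg (V * W) / rat}.

(* Dividing the free vector space on V * W by the span of [tensor_rel n]
   yields (V / fil n) tensor (W / fil n). *)
Inductive tensor_rel (n : nat) : set free :=
| rel_linl a v v' w :
    tensor_rel n (<< (a *: v + v', w) >> - (a *: << (v, w) >> + << (v', w) >>))
| rel_linr a v w w' :
    tensor_rel n (<< (v, a *: w + w') >> - (a *: << (v, w) >> + << (v, w') >>))
| rel_fill v w : fil n v -> tensor_rel n << (v, w) >>
| rel_filr v w : fil n w -> tensor_rel n << (v, w) >>.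

Definition tensor_level (n : nat) : set free := linspan (tensor_rel n).

Lemma tensor_full : tensor_level 0 = setT.
Proof.
apply/seteqP; split=> // x _; rewrite -[x]freeg_sumE.
elim: (dom x) => [|[v w] s IHs]; first by rewrite big_nil; apply: linspan0.
rewrite big_cons; suff -> : << coeff (v, w) x *g (v, w) >> =
    coeff (v, w) x *: << (v, w) >> :> free.
  by apply: linspan_lin IHs; apply: rel_fill; rewrite level_full.
by apply/eqP/freeg_eqP => k; rewrite coeffZ !coeffU mul1r.
Qed.

Lemma tensor_decr n : tensor_level n.+1 `<=` tensor_level n.
Proof.
move=> x; elim=> [|a {}x y rx _ IHy]; first exact: linspan0.
apply: linspan_lin IHy; case: rx => *; [exact: rel_linl | exact: rel_linr | |].
  by apply/rel_fill/level_decr.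
by apply/rel_filr/level_decr.
Qed.

Lemma tensor0 n : tensor_level n 0.
Proof. exact: linspan0. Qed.

Lemma tensor_lin n a x y :
  tensor_level n x -> tensor_level n y -> tensor_level n (a *: x + y).
Proof.
move=> Sx; elim: Sx y => [|b {}x z rx _ IHz] y Sy; first by rewrite scaler0 add0r.
by rewrite scalerDr scalerA -addrA; apply: linspan_lin => //; apply: IHz.
Qed.

Definition tensor_filtration :=
  Filtration tensor_full tensor_decr tensor0 tensor_lin.

Definition tensor := completion tensor_filtration.

HB.instance Definition _ := CFilt.on tensor.

Lemma const_coherent (x : free) :
  (fun=> x) \in coherent tensor_filtration.
Proof. by apply/asboolP => n; rewrite subrr; apply: linspan0. Qed.

Definition pure (v : V) (w : W) : tensor :=
  \pi_tensor (CoherentSeq (const_coherent << (v, w) >>)).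

(* Extension by linearity and continuity, meaningful for [f] bilinear and
   continuous for the completed tensor product: see [bilift_pure], [bilift_cl]
   and, for uniqueness, [tensor_ext]. *)
Definition bilift (Z : cfiltType) (f : V -> W -> Z) (t : tensor) : Z :=
  limit (fun n => fglift (fun vw => f vw.1 vw.2) (approx t n)).

Definition bounded_bilinear (Z : cfiltType) (f : V -> W -> Z) :=
  [/\ forall w, linear (f^~ w), forall v, linear (f v) &
      forall k, exists n, forall v w, fil n v \/ fil n w -> fil k (f v w)].

Lemma fglift_linear (Z : lmodType rat) (f : V * W -> Z) : linear (fglift f).
Proof.
pose h : {additive free -> Z} := HB.pack (fglift f)
  (GRing.isZmodMorphism.Build free Z (fglift f) (lift_is_additive f)).
have hZ a x : h (a *: x) = a *: h x.
  rewrite -[x in RHS]freeg_sumE [a *: x]/(fgscale a x) /fgscale !raddf_sum.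
  apply: eq_bigr => z _.
  by rewrite /= !liftU scalerA.
by move=> a x y; rewrite -(hZ a x); exact: (raddfD h).
Qed.

Section Lifting.
Variables (Z : cfiltType) (f : V -> W -> Z).
Hypothesis ff : bounded_bilinear f.

Let fl : free -> Z := fglift (fun vw => f vw.1 vw.2).

Let flU v w : fl << (v, w) >> = f v w.
Proof. by rewrite /fl liftU scale1r. Qed.

Let flD a x y : fl (a *: x + y) = a *: fl x + fl y.
Proof. exact: fglift_linear. Qed.

Let fl0 : fl 0 = 0.
Proof. by have := flD 1 0 0; rewrite !scale1r addr0 => /eqP; rewrite -subr_eq subrr => /eqP. Qed.

Let flB x y : fl (x - y) = fl x - fl y.
Proof. by rewrite addrC -scaleN1r flD scaleN1r addrC. Qed.

Let fl_bounded k : exists n, forall x, tensor_filtration n x -> fil k (fl x).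
Proof.
case: ff => fL fR /(_ k)[n fB]; exists n => x.
elim=> [|a {}x y rx _ IHy]; first by rewrite fl0; apply: level0.
rewrite flD; apply: level_lin IHy; case: rx => [b v v' w|b v w w'|v w fv|v w fw].
- by rewrite flB flD !flU fL subrr; apply: level0.
- by rewrite flB flD !flU fR subrr; apply: level0.
- by rewrite flU; apply: fB; left.
- by rewrite flU; apply: fB; right.
Qed.

Let approx_le (t : tensor) m n : (m <= n)%N ->
  tensor_filtration m (approx t n - approx t m).
Proof.
have decr j i : (i <= j)%N -> tensor_filtration j `<=` tensor_filtration i.
  move=> /subnK <-; elim: (j - i)%N => // d IH.
  by apply: subset_trans IH; rewrite addSn; apply: level_decr.
move=> /subnK <-; elim: (n - m)%N => [|d IH].
  by rewrite subrr; apply: level0.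
rewrite -[_ - _](subrKA (approx t (d + m))); apply: levelD IH.
by rewrite addSn; apply: decr (approx_coherent t _); rewrite leq_addl.
Qed.

Let bilift_cvg (t : tensor) : converges (fun n => fl (approx t n)) (bilift f t).
Proof.
suff /xgetPex : exists l, converges (fun n => fl (approx t n)) l by apply.
have [N NP] := choice fl_bounded.
pose N' k := (\sum_(i < k.+1) N i)%N.
have NN' k n : (N' k <= n)%N -> (N k <= n)%N.
  by apply: leq_trans; rewrite /N' big_ord_recr leq_addl.
have near k n : (N' k <= n)%N -> fil k (fl (approx t n) - fl (approx t (N' k))).
  move=> kn.
  rewrite -[_ - _](subrKA (fl (approx t (N k)))) -[X in _ + X]opprB.
  by apply: levelB; rewrite -flB; apply: NP; apply: approx_le => //; apply: NN'.
have [|l lP] := fil_complete (fun k => fl (approx t (N' k))).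
  by move=> k; apply: near; rewrite /N' [in leqRHS]big_ord_recr leq_addr.
exists l => k; exists (N' k) => n /near kn.
by rewrite -[_ - _](subrKA (fl (approx t (N' k)))) -[X in _ + X]opprB; apply: levelB.
Qed.

Let filtP (x y : Z) : (forall k, fil k (x - y)) -> x = y.
Proof. by move=> /fil_sep/eqP; rewrite subr_eq0 => /eqP. Qed.

Lemma bilift_pure v w : bilift f (pure v w) = f v w.
Proof.
apply: filtP => k.
have [N NP] := fl_bounded k; have [M /(_ (maxn N M))] := bilift_cvg (pure v w) k.
rewrite leq_maxr => /(_ isT) h.
rewrite -opprB; have -> : f v w - bilift f (pure v w) =
    (fl (approx (pure v w) (maxn N M)) - bilift f (pure v w)) -
    (fl (approx (pure v w) (maxn N M) - << (v, w) >>)).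
  by rewrite flB flU opprB [RHS]addrC subrKA.
rewrite -scaleN1r; apply/levelZ/levelB => //; apply: NP.
rewrite -[_ - _](subrKA (approx (pure v w) N)); apply: levelD.
  by apply: approx_le; rewrite leq_maxl.
exact: approx_pi.
Qed.

Lemma bilift_cl : continuous_linear (bilift f).
Proof.
split=> [a x y|k].
  apply: filtP => k.
  have [N NP] := fl_bounded k.
  have [M1 h1] := bilift_cvg x k; have [M2 h2] := bilift_cvg y k.
  have [M3 h3] := bilift_cvg (a *: x + y) k.
  pose n := (N + (M1 + (M2 + M3)))%N.
  have {}h1 : fil k (fl (approx x n) - bilift f x) by apply: h1; lia.
  have {}h2 : fil k (fl (approx y n) - bilift f y) by apply: h2; lia.
  have {}h3 : fil k (fl (approx (a *: x + y) n) - bilift f (a *: x + y)).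
    by apply: h3; lia.
  have h4 : fil k (fl (approx (a *: x + y) n) - (a *: fl (approx x n) + fl (approx y n))).
    rewrite -flD -flB; apply: NP.
    have := approx_lin a x y n; have : (N <= n)%N by rewrite leq_addr.
    move=> /subnK <-; elim: (n - N)%N (_ - _) => // d IH e.
    by rewrite addSn => /level_decr/IH.
  have := levelD (levelB h4 h3) (level_lin a h1 h2).
  have E (u l A B P Q : Z) :
      u - (A + B) - (u - l) + ((A - P) + (B - Q)) = l - (P + Q).
    by rewrite opprB [X in X + _]addrC subrKA [A - P + _]addrACA -opprD subrKA.
  by rewrite scalerBr E.
have [N NP] := fl_bounded k; exists N => t tN.
have [M /(_ (maxn N M))] := bilift_cvg t k; rewrite leq_maxr => /(_ isT) h.
rewrite -[bilift f t](subKr (fl (approx t (maxn N M)))); apply: levelB h.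
apply: NP; rewrite -[approx _ _](subrK (approx t N)); apply: levelD => //.
by apply: approx_le; rewrite leq_maxl.
Qed.

End Lifting.

Lemma tensor_ext (Z : cfiltType) (h1 h2 : tensor -> Z) :
  continuous_linear h1 -> continuous_linear h2 ->
  (forall v w, h1 (pure v w) = h2 (pure v w)) -> h1 = h2.
Proof.
move=> [h1L h1C] [h2L h2C] h12.
pose cst x : tensor := \pi_tensor (CoherentSeq (const_coherent x)).
have cstL : linear cst.
  move=> a x y; rewrite [RHS](_ : _ = \pi_tensor
      (a *: CoherentSeq (const_coherent x) + CoherentSeq (const_coherent y))).
    by congr (\pi_tensor _); apply: val_inj.
  by rewrite pi_completionD pi_quot_scale.
pose d t := h1 t - h2 t.
have dL : linear d.
  by move=> a x y; rewrite /d h1L h2L opprD addrACA -scalerBr.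
have d0 : d 0 = 0.
  by have := dL 1 0 0; rewrite !scale1r addr0 => /eqP; rewrite -subr_eq subrr => /eqP.
have cst0 : cst 0 = 0.
  by have := cstL 1 0 0; rewrite !scale1r addr0 => /eqP; rewrite -subr_eq subrr => /eqP.
have dcst x : d (cst x) = 0.
  rewrite -[x]freeg_sumE.
  elim: (dom x) => [|[v w] s IHs]; first by rewrite big_nil cst0.
  rewrite big_cons; have -> : << coeff (v, w) x *g (v, w) >> =
      coeff (v, w) x *: << (v, w) >> :> free.
    by apply/eqP/freeg_eqP => k; rewrite coeffZ !coeffU mul1r.
  rewrite cstL dL IHs [d _](_ : _ = 0) ?scaler0 ?addr0 //.
  by rewrite /d h12 subrr.
apply: funext => t; apply/eqP; rewrite -subr_eq0; apply/eqP; apply: fil_sep => k.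
have [n1 n1P] := h1C k; have [n2 n2P] := h2C k.
pose n := maxn n1 n2.
have decr j i : (i <= j)%N -> completion_level j `<=` completion_level (F := tensor_filtration) i.
  move=> /subnK <-; elim: (j - i)%N => // e IH.
  by apply: subset_trans IH; rewrite addSn; apply: completion_decr.
have tn : completion_level (F := tensor_filtration) n (t - cst (approx t n)).
  rewrite /completion_level /=.
  rewrite -[approx (t - _) n](subrK (approx t n - approx (cst (approx t n)) n)).
  apply: (levelD (F := tensor_filtration)); first exact: approxB.
  rewrite -opprB -scaleN1r; apply: (levelZ (F := tensor_filtration)).
  exact: approx_pi.
have -> : h1 t - h2 t = d (t - cst (approx t n)).
  by have := dL (-1) (cst (approx t n)) t; rewrite dcst scaler0 add0r scaleN1r addrC.
apply: levelB; [apply: n1P | apply: n2P].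
  by apply: decr tn; rewrite leq_maxl.
by apply: decr tn; rewrite leq_maxr.
Qed.

End Tensor.

Arguments tensor (V W)%_type.

Notation "V ⊗ W" := (tensor V W) (at level 40, left associativity) : type_scope.
Notation "v ⊗ w" := (pure v w) (at level 40, left associativity) : ring_scope.

Section TensorMaps.
Variables U V W V' W' : cfiltType.

Definition tmap (f : V -> V') (g : W -> W') : V ⊗ W -> V' ⊗ W' :=
  bilift (fun v w => f v ⊗ g w).

Definition assoc : (U ⊗ V) ⊗ W -> U ⊗ (V ⊗ W) :=
  bilift (fun t w => bilift (fun u v => u ⊗ (v ⊗ w)) t).

Definition assocV : U ⊗ (V ⊗ W) -> (U ⊗ V) ⊗ W :=
  bilift (fun u t => bilift (fun v w => (u ⊗ v) ⊗ w) t).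

Definition flip : V ⊗ W -> W ⊗ V := bilift (fun v w => w ⊗ v).

End TensorMaps.

Arguments assoc {U V W}.
Arguments assocV {U V W}.
Arguments flip {V W}.

Section Powers.
Variable g : cfiltType.

(* [tpow 1] and [tpow 2] are convertible to [g] and [g ⊗ g]. *)
Fixpoint tpow (p : nat) : cfiltType :=
  match p with
  | 0 => rat^o
  | p'.+1 => match p' with 0 => g | _.+1 => (g ⊗ tpow p')%type end
  end.

(* The decomposable tensor s_0 ⊗ ... ⊗ s_(p-1), for s of size p. *)
Fixpoint decomp (p : nat) (s : seq g) : tpow p :=
  match p return tpow p with
  | 0 => (1 : rat^o)
  | p'.+1 => match p' return tpow p' -> tpow p'.+1 with
             | 0 => fun=> s`_0
             | _.+1 => fun t => s`_0 ⊗ t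
             end (decomp p' (behead s))
  end.

(* The continuous linear map with value [f s] at [decomp p s], for [f]
   multilinear and uniformly continuous in its p arguments. *)
Fixpoint multilift (Z : cfiltType) (p : nat) (f : seq g -> Z) : tpow p -> Z :=
  match p return tpow p -> Z with
  | 0 => fun q : rat => q *: f [::]
  | p'.+1 =>
    match p' return ((seq g -> Z) -> tpow p' -> Z) -> tpow p'.+1 -> Z with
    | 0 => fun _ x => f [:: x]
    | _.+1 => fun rec => bilift (fun x t => rec (fun s => f (x :: s)) t)
    end (@multilift Z p')
  end.

Definition permute p (s : 'S_p) (x : seq g) : seq g :=
  [seq x`_(s i) | i <- enum 'I_p].

Definition perm_act p (s : 'S_p) : tpow p -> tpow p :=
  multilift (fun x => decomp p (permute s x)).

Definition ext_power p : set (tpow p) :=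
  [set t | forall s : 'S_p, perm_act s t = (-1) ^+ s *: t].

Definition wedge p (x : seq g) : tpow p :=
  \sum_(s : 'S_p) (-1) ^+ s *: decomp p (permute s x).

(* For [f] alternating, the restriction of this map to [ext_power p] is the
   continuous linear map with value [f x] at [wedge p x]: on tensors,
   [multilift f] sends [wedge p x] to [p`! * f x]. *)
Definition altlift (Z : cfiltType) p (f : seq g -> Z) (t : tpow p) : Z :=
  (p`!%:R)^-1 *: multilift f t.

Definition wedge_prod p q (t : tpow p) (t' : tpow q) : tpow (p + q) :=
  altlift (fun x => altlift (fun y => wedge (p + q) (x ++ y)) t') t.

End Powers.

Arguments decomp {g}.
Arguments perm_act {g} p.
Arguments ext_power {g} p.
Arguments wedge {g}.
Arguments wedge_prod {g} p q.

(* x with the entries of the given positions omitted, for x of size p *)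
Definition hat (g : cfiltType) p (x : seq g) (omitted : seq nat) : seq g :=
  [seq x`_k | k <- iota 0 p & k \notin omitted].

Unset Implicit Arguments.

Section LieBialgebra.
Variables (g : cfiltType) (nabla : g ⊗ g -> g).

Local Notation "[[ x , y ]]" := (nabla (x ⊗ y)) (at level 0).

Definition ad (y : g) : g -> g := fun x => [[y, x]].

Record is_lie_algebra : Prop := IsLieAlgebra {
  nabla_cl : continuous_linear nabla;
  nabla_alt : forall x, [[x, x]] = 0;
  nabla_jacobi : forall x y z,
    [[x, [[y, z]]]] + [[y, [[z, x]]]] + [[z, [[x, y]]]] = 0 }.

Definition sigma (p : nat) (y : g) : tpow g p -> tpow g p :=
  altlift (fun x => \sum_(i < p) wedge p (set_nth 0 x i [[y, x`_i]])).

(* Positions are counted from 0, whence the sign [(-1) ^+ i.+1] for the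
   position [i]. *)
Definition boundary (p : nat) : tpow g p -> tpow g p.-1 :=
  altlift (fun x => \sum_(i < p) \sum_(j < p | (i < j)%N)
    (-1) ^+ (i.+1 + j.+1) *: wedge p.-1 ([[x`_i, x`_j]] :: hat p x [:: val i; val j])).

Definition cyc3 : tpow g 3 -> tpow g 3 :=
  multilift (fun x => decomp 3 [:: x`_2; x`_0; x`_1]).

Definition cycN (t : tpow g 3) : tpow g 3 := t + cyc3 t + cyc3 (cyc3 t).

Variable delta : g -> g ⊗ g.

Record is_involutive_lie_bialgebra : Prop := IsInvolutiveLieBialgebra {
  bialg_lie : is_lie_algebra;
  delta_cl : continuous_linear delta;
  delta_ext : forall x, ext_power 2 (delta x);
  delta_cojacobi : forall x, cycN (assoc (tmap delta id (delta x))) = 0;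
  delta_cocycle : forall x y,
    delta [[x, y]] = sigma 2 x (delta y) - sigma 2 y (delta x);
  delta_involutive : forall x, nabla (delta x) = 0 }.

Definition codiff (p : nat) : tpow g p -> tpow g p.+1 :=
  match p return tpow g p -> tpow g p.+1 with
  | 0 => fun=> 0
  | q.+1 => altlift (fun x => \sum_(i < q.+1) (-1) ^+ i.+1 *:
      wedge_prod 2 q (delta x`_i) (wedge q (hat q.+1 x [:: val i])))
  end.

End LieBialgebra.

Arguments ad {g}.
Arguments is_lie_algebra {g}.
Arguments sigma {g}.
Arguments boundary {g}.
Arguments cycN {g}.
Arguments is_involutive_lie_bialgebra {g}.
Arguments codiff {g}.

Section Bimodule.
Variables (g M : cfiltType) (nabla : g ⊗ g -> g) (act : g ⊗ M -> M).

Definition sigmaM (y : g) : M -> M := fun m => act (y ⊗ m).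

Definition sigma_bar : M ⊗ g -> M := bilift (fun m y => - act (y ⊗ m)).

Record is_module : Prop := IsModule {
  act_cl : continuous_linear act;
  act_bracket : forall x y m, act (nabla (x ⊗ y) ⊗ m) =
    act (x ⊗ act (y ⊗ m)) - act (y ⊗ act (x ⊗ m)) }.

Definition sigma_tensor (p : nat) (y : g) : M ⊗ tpow g p -> M ⊗ tpow g p :=
  bilift (fun m xi => act (y ⊗ m) ⊗ xi + m ⊗ sigma nabla p y xi).

Definition Gamma (p : nat) : M ⊗ tpow g p -> M ⊗ tpow g p.-1 :=
  bilift (fun m => altlift (fun x => \sum_(i < p) (-1) ^+ i.+1 *:
    (act (x`_i ⊗ m) ⊗ wedge p.-1 (hat p x [:: val i])))).

Definition boundaryM (p : nat) : M ⊗ tpow g p -> M ⊗ tpow g p.-1 :=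
  bilift (fun m xi => Gamma p (m ⊗ xi) + m ⊗ boundary nabla p xi).

Definition wedgeM (p q : nat) (u : M ⊗ tpow g p) (eta : tpow g q) :
    M ⊗ tpow g (p + q) :=
  bilift (fun m xi => m ⊗ wedge_prod p q xi eta) u.

(* M ⊗ Λ^p g, as the alternating part of M ⊗ g^(⊗ p); [boundaryM] and [codiffM]
   are defined on all of M ⊗ g^(⊗ p) through [altlift], and only their
   restrictions to [chains] are meaningful. *)
Definition chains (p : nat) : set (M ⊗ tpow g p) :=
  [set u | forall s : 'S_p, tmap id (perm_act p s) u = (-1) ^+ s *: u].

Definition cycles (p : nat) : set (M ⊗ tpow g p) :=
  [set u | chains p u /\ boundaryM p u = 0].

Definition boundaries (p : nat) : set (M ⊗ tpow g p) :=
  [set boundaryM p.+1 w | w in chains p.+1].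

Definition hclass (p : nat) (u : M ⊗ tpow g p) : set (M ⊗ tpow g p) :=
  [set v | cycles p v /\ boundaries p (v - u)].

(* H_p(g; M), as the set of cosets of [boundaries p] in [cycles p] *)
Definition homology (p : nat) : set (set (M ⊗ tpow g p)) :=
  [set hclass p u | u in cycles p].

Variables (delta : g -> g ⊗ g) (mu : M -> M ⊗ g).

Record is_involutive_bimodule : Prop := IsInvolutiveBimodule {
  bimod_module : is_module;
  mu_cl : continuous_linear mu;
  mu_comodule : forall m, tmap id delta (mu m) =
    tmap id (fun t => t - flip t) (assoc (tmap mu id (mu m)));
  mu_compat : forall m y, sigma_tensor 1 y (mu m) - mu (act (y ⊗ m))
    - tmap sigma_bar id (assocV (tmap id delta (m ⊗ y))) = 0;
  mu_involutive : forall m, sigma_bar (mu m) = 0 }.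

Definition codiffM (p : nat) : M ⊗ tpow g p -> M ⊗ tpow g p.+1 :=
  bilift (fun m xi => wedgeM 1 p (mu m) xi + m ⊗ codiff delta p xi).

(* The map [u] |-> [d^M u] from H_p(g; M) to H_(p+1)(g; M): the classes of
   d^M u, for u ranging over c in H_p(g; M), all coincide. *)
Definition codiff_homology (p : nat) (c : set (M ⊗ tpow g p)) :
    set (M ⊗ tpow g p.+1) :=
  \bigcup_(u in c) hclass p.+1 (codiffM p u).

End Bimodule.

Arguments sigmaM {g M}.
Arguments is_involutive_bimodule {g M}.
Arguments homology {g M}.
Arguments codiff_homology {g M}.

Set Implicit Arguments.

Record top_aut (V : cfiltType) := TopAut {
  aut :> V -> V;
  autV : V -> V;
  aut_cl : continuous_linear aut;
  autV_cl : continuous_linear autV;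
  autK : cancel aut autV;
  autVK : cancel autV aut }.

Definition lie_morphism (g : cfiltType) (nabla : g ⊗ g -> g) (f : g -> g) :=
  forall x y, f (nabla (x ⊗ y)) = nabla (f x ⊗ f y).

Definition transport_delta (g : cfiltType) (U : top_aut g)
    (delta : g -> g ⊗ g) : g -> g ⊗ g :=
  fun x => tmap U U (delta (autV U x)).

Definition transport_mu (g M : cfiltType) (U : top_aut g) (UM : top_aut M)
    (mu : M -> M ⊗ g) : M -> M ⊗ g :=
  fun m => tmap UM U (mu (autV UM m)).

Definition exp_converges_to (V : cfiltType) (f U : V -> V) :=
  forall v, converges (fun n => \sum_(k < n) (k`!%:R)^-1 *: iter k f v) (U v).

(* Main.v *)
(* Let E be e^(ad X) on every factor of g and e^(sigma X) on M. The transported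
   codifferential is E d E^-1, so it suffices that E acts trivially in homology. On
   chains, E is the exponential of the derivation D given by the action of X.
   Cartan's formula
     boundary (X /\ u) + X /\ boundary u = - D u
   and E - 1 = D l with l = sum_k D^k / (k + 1)! show that, for a cycle u,
   E u - u is the boundary of - X /\ l u, as D, hence l, commutes with the boundary.

   The filtrations consist of rational subspaces, so a series converges as soon as
   its terms tend to 0, whatever its rational coefficients. By Baire's theorem the
   pointwise convergence of e^(ad X) and e^(sigma X) makes the iterates of ad X and
   sigma X equicontinuous, whence the convergence on completed tensor products. *)

From mathcomp.multinomials Require Import freeg.
Require Import Defs.
From mathcomp Require Import all_boot all_order all_fingroup all_algebra.
From mathcomp Require Import zify generic_quotient.
From mathcomp Require Import boolp classical_sets.

Set Implicit Arguments.
Unset Strict Implicit.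
Unset Printing Implicit Defensive.

Import GRing.Theory.
Local Open Scope ring_scope.

(** * Complete filtered spaces and bounded bilinear maps *)

(** Boundaries need not form a closed subspace, which shapes the argument: for a cycle u each D^k u
    with k > 0 is a boundary, but this says nothing about the limit E u - u. The operator l sums the
    primitives first, and Cartan's formula is applied once, to the limit.

    The operators of the statement are sums over positions, with hats and signs, tested on wedges.
    To make continuity and Cartan's formula accessible, they are recast on the whole tensor power as
    recursions on the first factor, preceded by the projector [alt]. By [asym_tcons], wedging with a
    vector is the signed shuffle product [tshuf]; the sum over pairs in the boundary becomes
    [contract], which brackets the first factor into the others. Most identities then hold for
    arbitrary tensors. Since a continuous linear map on a completed tensor power is determined by
    its values on [tcons x t], each of them is a short induction on the degree. The factor 1/2 in
    front of [contract] is there because every pair is met in both orders. *)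

Section Filtered.
Variable V : cfiltType.
Implicit Types (x y : V) (a : nat -> V).

Lemma fil_le m n x : (m <= n)%N -> fil n x -> fil m x.
Proof. by move=> /subnK <-; elim: (n - m)%N => // d IH /level_decr/IH. Qed.

Lemma fil_sum n I (r : seq I) (P : pred I) (F : I -> V) :
  (forall i, P i -> fil n (F i)) -> fil n (\sum_(i <- r | P i) F i).
Proof.
move=> FP; elim/big_ind: _ => //; first exact: level0.
by move=> *; apply: levelD.
Qed.

Lemma fil_eq x y : (forall n, fil n (x - y)) -> x = y.
Proof. by move=> /fil_sep/eqP; rewrite subr_eq0 => /eqP. Qed.

Lemma converges_unique a x y : converges a x -> converges a y -> x = y.
Proof.
move=> ax ay; apply: fil_eq => n.
have [N1 h1] := ax n; have [N2 h2] := ay n.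
have := levelB (h2 _ (leq_maxr N1 N2)) (h1 _ (leq_maxl N1 N2)).
by rewrite opprB addrC subrKA.
Qed.

Definition vanishing a := forall n, exists N, forall k, (N <= k)%N -> fil n (a k).

Lemma series_vanishing a x :
  converges (fun n => \sum_(k < n) a k) x -> vanishing a.
Proof.
move=> ax n; have [N NP] := ax n; exists N => k Nk.
have := levelB (NP k.+1 (leqW Nk)) (NP k Nk).
by rewrite big_ord_recr /= opprB addrA subrK [_ + a k]addrC addrK.
Qed.

Lemma vanishing_series a :
  vanishing a -> exists x, converges (fun n => \sum_(k < n) a k) x.
Proof.
(* Summing the moduli makes [N'] nondecreasing, so that [S (N' k)] is Cauchy at rate [k], as
   [fil_complete] requires. *)
move=> /choice[N NP]; pose N' k := (\sum_(i < k.+1) N i)%N.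
pose S n := \sum_(k < n) a k.
have NN' k : (N k <= N' k)%N by rewrite /N' big_ord_recr leq_addl.
have near k n : (N' k <= n)%N -> fil k (S n - S (N' k)).
  move=> /subnK <-; elim: (n - N' k)%N => [|d IH].
    by rewrite subrr; apply: level0.
  rewrite addSn /S big_ord_recr /= addrAC; apply: levelD => //.
  by apply: NP; apply: leq_trans (NN' k) (leq_addl _ _).
have [|x xP] := fil_complete (fun k => S (N' k)).
  by move=> k; apply: near; rewrite /N' [in leqRHS]big_ord_recr leq_addr.
exists x => k; exists (N' k) => n /near kn.
by rewrite -[_ - _](subrKA (S (N' k))) -[X in _ + X]opprB; apply: levelB.
Qed.

End Filtered.

Section ContinuousLinear.
Variables V W Z : cfiltType.

Section Morph.
Variables (f : V -> W) (hf : continuous_linear f).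

Lemma clP a x y : f (a *: x + y) = a *: f x + f y.
Proof. exact: hf.1. Qed.

Lemma clD x y : f (x + y) = f x + f y.
Proof. by rewrite -[x in LHS]scale1r clP scale1r. Qed.

Lemma cl0 : f 0 = 0.
Proof. by have /eqP := clD 0 0; rewrite addr0 -subr_eq subrr => /eqP. Qed.

Lemma clZ a x : f (a *: x) = a *: f x.
Proof. by rewrite -[a *: x]addr0 clP cl0 addr0. Qed.

Lemma clN x : f (- x) = - f x.
Proof. by rewrite -scaleN1r clZ scaleN1r. Qed.

Lemma clB x y : f (x - y) = f x - f y.
Proof. by rewrite clD clN. Qed.

Lemma cl_sum I (r : seq I) (P : pred I) (F : I -> V) :
  f (\sum_(i <- r | P i) F i) = \sum_(i <- r | P i) f (F i).
Proof. exact: (big_morph f clD cl0). Qed.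

Lemma cl_converges x l : converges x l -> converges (fun n => f (x n)) (f l).
Proof.
move=> xl k; have [m mP] := hf.2 k; have [N NP] := xl m.
by exists N => n Nn; rewrite -clB; apply/mP/NP.
Qed.

End Morph.

Lemma cl_eq (f h : V -> W) : f =1 h -> continuous_linear f -> continuous_linear h.
Proof. by move=> /funext ->. Qed.

Lemma cl_id : continuous_linear (@id V).
Proof. by split=> // n; exists n. Qed.

Lemma cl_zero : continuous_linear (fun _ : V => 0 : W).
Proof.
by split=> [a x y|n]; [rewrite scaler0 addr0 | exists 0%N => *; apply: level0].
Qed.

Lemma cl_comp (f : V -> W) (h : W -> Z) : continuous_linear f ->
  continuous_linear h -> continuous_linear (fun x => h (f x)).
Proof.
move=> [fL fC] [hL hC]; split=> [a x y|n]; first by rewrite fL hL.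
by have [m mP] := hC n; have [l lP] := fC m; exists l => x /lP/mP.
Qed.

Lemma cl_add (f h : V -> W) : continuous_linear f -> continuous_linear h ->
  continuous_linear (fun x => f x + h x).
Proof.
move=> [fL fC] [hL hC]; split=> [a x y|n].
  by rewrite fL hL scalerDr addrACA.
have [m mP] := fC n; have [l lP] := hC n; exists (maxn m l) => x xP.
by apply: levelD; [apply/mP/(fil_le _ xP)/leq_maxl | apply/lP/(fil_le _ xP)/leq_maxr].
Qed.

Lemma cl_scale c (f : V -> W) : continuous_linear f ->
  continuous_linear (fun x => c *: f x).
Proof.
move=> [fL fC]; split=> [a x y|n].
  by rewrite fL scalerDr !scalerA mulrC.
by have [m mP] := fC n; exists m => x /mP; apply: levelZ.
Qed.

Lemma cl_opp (f : V -> W) : continuous_linear f -> continuous_linear (fun x => - f x).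
Proof. by move=> /(cl_scale (-1)); apply: cl_eq => x; rewrite scaleN1r. Qed.

Lemma cl_sub (f h : V -> W) : continuous_linear f -> continuous_linear h ->
  continuous_linear (fun x => f x - h x).
Proof. by move=> fP /cl_opp; apply: cl_add. Qed.

Lemma cl_bigsum I (r : seq I) (P : pred I) (F : I -> V -> W) :
  (forall i, continuous_linear (F i)) ->
  continuous_linear (fun x => \sum_(i <- r | P i) F i x).
Proof.
move=> FP; elim: r => [|i r IHr].
  by apply: cl_eq cl_zero => x; rewrite big_nil.
case Pi: (P i).
  by apply: cl_eq (cl_add (FP i) IHr) => x; rewrite big_cons Pi.
by apply: cl_eq IHr => x; rewrite big_cons Pi.
Qed.

End ContinuousLinear.

Section Bilinear.
Variables V W Z : cfiltType.

Lemma bb_intro (f : V -> W -> Z) :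
  (forall a v v' w, f (a *: v + v') w = a *: f v w + f v' w) ->
  (forall a v w w', f v (a *: w + w') = a *: f v w + f v w') ->
  (forall k, exists n, (forall v w, fil n v -> fil k (f v w)) /\
     forall v w, fil n w -> fil k (f v w)) -> bounded_bilinear f.
Proof.
move=> fL fR fB; split=> [w a x y|v a x y|k]; [exact: fL | exact: fR |].
by have [n [h1 h2]] := fB k; exists n => v w []; auto.
Qed.

Section Morph.
Variables (f : V -> W -> Z) (hf : bounded_bilinear f).

Lemma bb_cll w : continuous_linear (f^~ w).
Proof.
case: hf => fL _ fB; split; first exact: fL.
by move=> k; have [n nP] := fB k; exists n => v vn; apply: nP; left.
Qed.

Lemma bb_clr v : continuous_linear (f v).
Proof.
case: hf => _ fR fB; split; first exact: fR.
by move=> k; have [n nP] := fB k; exists n => w wn; apply: nP; right.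
Qed.

Lemma bb_flip : bounded_bilinear (fun w v => f v w).
Proof.
case: hf => fL fR fB; split=> // k; have [n nP] := fB k.
by exists n => v w [?|?]; apply: nP; [right | left].
Qed.

End Morph.

Lemma bb_eq (f h : V -> W -> Z) : f =2 h -> bounded_bilinear f -> bounded_bilinear h.
Proof. by move=> fh; have -> : h = f by apply/funext => v; apply/funext => w. Qed.

Lemma bb_add (f h : V -> W -> Z) : bounded_bilinear f -> bounded_bilinear h ->
  bounded_bilinear (fun v w => f v w + h v w).
Proof.
move=> fP hP; split=> [w|v|k].
- exact: (cl_add (bb_cll fP w) (bb_cll hP w)).1.
- exact: (cl_add (bb_clr fP v) (bb_clr hP v)).1.
have [_ _ /(_ k)[n nP]] := fP; have [_ _ /(_ k)[m mP]] := hP.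
exists (maxn n m) => v w vw; apply: levelD; [apply: nP | apply: mP].
  by case: vw => /(fil_le (leq_maxl n m)); [left | right].
by case: vw => /(fil_le (leq_maxr n m)); [left | right].
Qed.

Lemma bb_comp (V' W' Z' : cfiltType) (f : V -> W -> Z) (a : V' -> V) (b : W' -> W)
    (c : Z -> Z') : bounded_bilinear f -> continuous_linear a ->
  continuous_linear b -> continuous_linear c ->
  bounded_bilinear (fun v w => c (f (a v) (b w))).
Proof.
move=> fP aP bP cP; split=> [w|v|k].
- exact: (cl_comp (cl_comp aP (bb_cll fP (b w))) cP).1.
- exact: (cl_comp (cl_comp bP (bb_clr fP (a v))) cP).1.
have [k' k'P] := cP.2 k; have [_ _ /(_ k')[n nP]] := fP.
have [i iP] := aP.2 n; have [j jP] := bP.2 n.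
exists (maxn i j) => v w vw; apply/k'P/nP.
case: vw => [/(fil_le (leq_maxl i j))/iP|/(fil_le (leq_maxr i j))/jP].
  by left.
by right.
Qed.

End Bilinear.

(** * Completed tensor products *)

Section TensorDensity.
Local Open Scope quotient_scope.
Variables V W : cfiltType.
Local Notation free := {freeg (V * W) / rat}.
Local Notation lev := (@tensor_filtration V W).

(** The canonical map from the free space to the completion; its image is dense by [ften_near]. *)
Definition ften (x : free) : V ⊗ W :=
  \pi_(V ⊗ W)%type (CoherentSeq (const_coherent x)).

Lemma ften_linear a x y : ften (a *: x + y) = a *: ften x + ften y.
Proof.
rewrite [RHS](_ : _ = \pi_(V ⊗ W)%type
    (a *: CoherentSeq (const_coherent x) + CoherentSeq (const_coherent y))).
  by congr (\pi_(V ⊗ W)%type _); apply: val_inj.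
by rewrite pi_completionD pi_quot_scale.
Qed.

Lemma ften_fil n x : lev n x -> fil n (ften x).
Proof.
move=> xn; rewrite [fil n _](_ : _ = lev n (approx (ften x) n)) //.
by rewrite -[approx _ _](subrK x); apply: levelD => //; apply: approx_pi.
Qed.

Lemma ften_near n (t : V ⊗ W) : fil n (t - ften (approx t n)).
Proof.
rewrite [fil n _](_ : _ = lev n (approx (t - ften (approx t n)) n)) //.
rewrite -[approx (t - _) n](subrK (approx t n - approx (ften (approx t n)) n)).
apply: levelD; first exact: approxB.
rewrite -opprB -scaleN1r; apply: levelZ; exact: approx_pi.
Qed.

Lemma ften_eq x y : (forall n, lev n (x - y)) -> ften x = ften y.
Proof.
move=> xy; apply: fil_eq => n.
have -> : ften x - ften y = ften (x - y).
  by have := ften_linear (-1) y x; rewrite !scaleN1r addrC [RHS]addrC => ->.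
exact: ften_fil.
Qed.

Lemma pureE v w : v ⊗ w = ften << (v, w) >>.
Proof. by []. Qed.

Lemma pure_fil n (v : V) (w : W) : fil n v \/ fil n w -> fil n (v ⊗ w).
Proof.
move=> h; apply: ften_fil; rewrite -[<< _ >>]scale1r -[_ *: _]addr0.
by case: h => h; apply: linspan_lin; [apply: rel_fill | apply: linspan0
  | apply: rel_filr | apply: linspan0].
Qed.

Lemma pure_bb : bounded_bilinear (@pure V W).
Proof.
apply: bb_intro => [a v v' w|a v w w'|k].
- rewrite !pureE -ften_linear; apply: ften_eq => n.
  rewrite -[_ - _]scale1r -[_ *: _]addr0.
  by apply: linspan_lin; [apply: rel_linl | apply: linspan0].
- rewrite !pureE -ften_linear; apply: ften_eq => n.
  rewrite -[_ - _]scale1r -[_ *: _]addr0.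
  by apply: linspan_lin; [apply: rel_linr | apply: linspan0].
by exists k; split=> v w h; apply: pure_fil; [left | right].
Qed.

Definition pures n : set (V ⊗ W) :=
  fun t => exists v w, (fil n v \/ fil n w) /\ t = v ⊗ w.

(** The bilinearity relations among the generators of [lev n] lie in every level, hence vanish in
    the completion; only pure tensors with a factor in [fil n] survive. *)
Lemma tensor_dense n N (t : V ⊗ W) : (n <= N)%N -> fil n t ->
  exists2 x, linspan (pures n) x & fil N (t - x).
Proof.
move=> nN tn; exists (ften (approx t N)); last exact: ften_near.
have : lev n (approx t N).
  move: nN => /subnK <-; elim: (N - n)%N => // d IH.
  rewrite addSn -[approx _ _](subrK (approx t (d + n))); apply: levelD => //.
  have := approx_coherent t (d + n); elim: d {IH} (_ - _) => // d IH e.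
  by rewrite addSn => /level_decr/IH.
have ften0 : ften 0 = 0.
  by have /eqP := ften_linear 1 0 0; rewrite !scale1r addr0 -subr_eq subrr => /eqP.
elim=> [|a x y rx _ IHy]; first by rewrite ften0; apply: linspan0.
rewrite ften_linear; case: rx => [b v v' w|b v w w'|v w vn|v w wn].
- rewrite [ften _](_ : _ = 0) ?scaler0 ?add0r // -ften0.
  apply: ften_eq => m; rewrite subr0 -[_ - _]scale1r -[_ *: _]addr0.
  by apply: linspan_lin; [apply: rel_linl | apply: linspan0].
- rewrite [ften _](_ : _ = 0) ?scaler0 ?add0r // -ften0.
  apply: ften_eq => m; rewrite subr0 -[_ - _]scale1r -[_ *: _]addr0.
  by apply: linspan_lin; [apply: rel_linr | apply: linspan0].
- by apply: linspan_lin IHy; exists v, w; split=> //; left.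
- by apply: linspan_lin IHy; exists v, w; split=> //; right.
Qed.

(** A quantitative form of [bilift_cl]: the modulus of [f] serves for [bilift f] as it stands. This
    gives bounds that are uniform over a family of bilinear maps, as in [bilift_bb] and
    [sumder_equicontinuous]. *)
Lemma bilift_fil (Z : cfiltType) (f : V -> W -> Z) n k (t : V ⊗ W) :
  bounded_bilinear f -> (forall v w, fil n v \/ fil n w -> fil k (f v w)) ->
  fil n t -> fil k (bilift f t).
Proof.
move=> fP fk tn; have fcl := bilift_cl fP.
have [N NP] := fcl.2 k.
have [x xP tx] := tensor_dense (leq_maxr N n) tn.
rewrite -[t](subrK x) (clD fcl); apply: levelD.
  exact/NP/(fil_le _ tx)/leq_maxl.
elim: xP => [|a y z [v [w [vw ->]]] _ IHz]; first by rewrite (cl0 fcl); apply: level0.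
by rewrite (clP fcl) bilift_pure //; apply: level_lin => //; apply: fk.
Qed.

End TensorDensity.

Lemma tensor_eq (V W Z : cfiltType) (F G : V ⊗ W -> Z) :
  continuous_linear F -> continuous_linear G ->
  (forall v w, F (v ⊗ w) = G (v ⊗ w)) -> F =1 G.
Proof. by move=> hF hG FG t; rewrite (tensor_ext hF hG FG). Qed.

(** The condition that lets one argument be a parameter of a [bilift] in the two others: see
    [bilift_bb]. *)
Definition bounded_trilinear (U V W Z : cfiltType) (f : U -> V -> W -> Z) :=
  [/\ forall v w, linear (fun u => f u v w), forall u w, linear (fun v => f u v w),
      forall u v, linear (f u v) &
      forall k, exists n, forall u v w, [\/ fil n u, fil n v | fil n w] ->
        fil k (f u v w)].

Section Trilinear.
Variables U V W Z : cfiltType.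

Lemma tri_add (f h : U -> V -> W -> Z) : bounded_trilinear f ->
  bounded_trilinear h -> bounded_trilinear (fun u v w => f u v w + h u v w).
Proof.
move=> [f1 f2 f3 fB] [h1 h2 h3 hB]; split=> [v w|u w|u v|k].
- by move=> a x y; rewrite f1 h1 scalerDr addrACA.
- by move=> a x y; rewrite f2 h2 scalerDr addrACA.
- by move=> a x y; rewrite f3 h3 scalerDr addrACA.
have [n nP] := fB k; have [m mP] := hB k.
exists (maxn n m) => u v w uvw; apply: levelD; [apply: nP | apply: mP].
  by case: uvw => /(fil_le (leq_maxl n m));
    [constructor 1 | constructor 2 | constructor 3].
by case: uvw => /(fil_le (leq_maxr n m));
  [constructor 1 | constructor 2 | constructor 3].
Qed.

Lemma tri_comp (Y Z' : cfiltType) (f : U -> Y -> Z) (h : V -> W -> Y) (c : Z -> Z') :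
  bounded_bilinear f -> bounded_bilinear h -> continuous_linear c ->
  bounded_trilinear (fun u v w => c (f u (h v w))).
Proof.
move=> fP hP cP; split=> [v w|u w|u v|k].
- exact: (cl_comp (bb_cll fP _) cP).1.
- exact: (cl_comp (cl_comp (bb_cll hP w) (bb_clr fP u)) cP).1.
- exact: (cl_comp (cl_comp (bb_clr hP v) (bb_clr fP u)) cP).1.
have [k' k'P] := cP.2 k; have [_ _ /(_ k')[n nP]] := fP.
have [_ _ /(_ n)[m mP]] := hP; exists (maxn n m) => u v w uvw; apply/k'P/nP.
case: uvw =>
    [/(fil_le (leq_maxl n m))|/(fil_le (leq_maxr n m))|/(fil_le (leq_maxr n m))].
- by left.
- by right; apply: mP; left.
- by right; apply: mP; right.
Qed.

Lemma tri_swap (f : U -> V -> W -> Z) : bounded_trilinear f ->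
  bounded_trilinear (fun v u w => f u v w).
Proof.
move=> [f1 f2 f3 fB]; split=> // k; have [n nP] := fB k.
exists n => v u w h; apply: nP.
by case: h; [constructor 2 | constructor 1 | constructor 3].
Qed.

Lemma tri_rot (f : U -> V -> W -> Z) : bounded_trilinear f ->
  bounded_trilinear (fun w u v => f u v w).
Proof.
move=> [f1 f2 f3 fB]; split=> // k; have [n nP] := fB k.
exists n => v u w h; apply: nP.
by case: h; [constructor 3 | constructor 1 | constructor 2].
Qed.

Lemma tri_bb (f : U -> V -> W -> Z) u : bounded_trilinear f -> bounded_bilinear (f u).
Proof.
move=> [f1 f2 f3 fB]; split=> // k; have [n nP] := fB k.
by exists n => v w [h|h]; apply: nP; [constructor 2 | constructor 3].
Qed.

Lemma bilift_bb (f : U -> V -> W -> Z) : bounded_trilinear f ->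
  bounded_bilinear (fun u t => bilift (f u) t).
Proof.
move=> fP; have fb u := tri_bb u fP; case: (fP) => f1 f2 f3 fB.
apply: bb_intro => [a u u' t|a u t t'|k]; last first.
- have [n nP] := fB k; exists n; split=> u t h.
    (* A small [u] must serve for every [t], so [t] is only known to lie in level 0, which is the
       whole space. *)
    apply: (bilift_fil (n := 0)) => //; last by rewrite level_full.
    by move=> v w _; apply: nP; constructor 1.
  apply: (bilift_fil (n := n)) => // v w [?|?]; apply: nP.
    by constructor 2.
  by constructor 3.
- exact: (clP (bilift_cl (fb u))).
move: t; apply: tensor_eq; first exact: bilift_cl.
  by apply: cl_add; first apply: cl_scale; apply: bilift_cl.
by move=> v w; rewrite !bilift_pure //; apply: f1.
Qed.

End Trilinear.

Lemma pure_cl (V W : cfiltType) (v : V) : continuous_linear (fun w : W => v ⊗ w).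
Proof. exact: bb_clr (pure_bb V W) v. Qed.

Lemma pure_cll (V W : cfiltType) (w : W) : continuous_linear (fun v : V => v ⊗ w).
Proof. exact: bb_cll (pure_bb V W) w. Qed.

Section TensorMaps.
Variables V W V' W' : cfiltType.
Variables (f : V -> V') (h : W -> W').
Hypotheses (hf : continuous_linear f) (hh : continuous_linear h).

Lemma tmap_bb : bounded_bilinear (fun v w => f v ⊗ h w).
Proof. exact: bb_comp (pure_bb V' W') hf hh (cl_id _). Qed.

Lemma tmap_cl : continuous_linear (tmap f h).
Proof. exact: bilift_cl tmap_bb. Qed.

Lemma tmap_pure v w : tmap f h (v ⊗ w) = f v ⊗ h w.
Proof. exact: (bilift_pure tmap_bb). Qed.

End TensorMaps.

(** * Tensor powers and permutations *)

Section TensorPowers.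
Variable g : cfiltType.

(** [tpow 1] is [g] and not [g ⊗ tpow 0]. [tcons] and its eliminator [tlift] hide this exception, so
    that later recursions on the degree are uniform. *)
Definition tcons p : g -> tpow g p -> tpow g p.+1 :=
  match p return g -> tpow g p -> tpow g p.+1 with
  | 0 => fun x (q : rat^o) => (q : rat) *: x
  | _.+1 => fun x t => x ⊗ t
  end.

Lemma tcons_bb p : bounded_bilinear (@tcons p).
Proof.
case: p => [|p]; last exact: pure_bb.
apply: bb_intro => [a v v' w|a v w w'|k] /=.
- by rewrite scalerDr !scalerA mulrC.
- by rewrite scalerDl scalerA.
(* Not [k]: level 0 of [rat] contains all scalars, and only a positive level forces a scalar to be
   0. *)
exists k.+1; split=> v w; first by move=> /level_decr; apply: levelZ.
by case=> // ->; rewrite scale0r; apply: level0.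
Qed.

Lemma tpow0_ext (Z : cfiltType) (F G : tpow g 0 -> Z) : continuous_linear F ->
  continuous_linear G -> F (1 : rat^o) = G (1 : rat^o) -> F =1 G.
Proof.
move=> hF hG FG q; have -> : q = (q : rat) *: (1 : rat^o).
  by rewrite /GRing.scale /= mulr1.
by rewrite (clZ hF) (clZ hG) FG.
Qed.

Lemma tpow_ext p (Z : cfiltType) (F G : tpow g p.+1 -> Z) : continuous_linear F ->
  continuous_linear G -> (forall x t, F (tcons x t) = G (tcons x t)) -> F =1 G.
Proof.
case: p F G => [|p] F G hF hG FG t; last by rewrite (tensor_ext hF hG FG).
by have /= := FG t (1 : rat^o); rewrite scale1r.
Qed.

Definition tlift p (Z : cfiltType) : (g -> tpow g p -> Z) -> tpow g p.+1 -> Z :=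
  match p return (g -> tpow g p -> Z) -> tpow g p.+1 -> Z with
  | 0 => fun f x => f x (1 : rat^o)
  | _.+1 => fun f => bilift f
  end.

Lemma tlift_cl p (Z : cfiltType) (f : g -> tpow g p -> Z) :
  bounded_bilinear f -> continuous_linear (tlift f).
Proof. by case: p f => [|p] f fP; [apply: bb_cll | apply: bilift_cl]. Qed.

Lemma tlift_tcons p (Z : cfiltType) (f : g -> tpow g p -> Z) x t :
  bounded_bilinear f -> tlift f (tcons x t) = f x t.
Proof.
case: p f t => [|p] f t fP; last exact: bilift_pure.
rewrite /= (clZ (bb_cll fP _)) -(clZ (bb_clr fP _)).
by congr (f x _); rewrite /GRing.scale /= mulr1.
Qed.

Lemma tlift_bb p (U Z : cfiltType) (f : U -> g -> tpow g p -> Z) :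
  bounded_trilinear f -> bounded_bilinear (fun u => tlift (f u)).
Proof.
case: p f => [|p] f fP; last exact: bilift_bb.
case: fP => f1 f2 f3 fB; split=> //= k; have [n nP] := fB k.
by exists n => u x [h|h]; apply: nP; [constructor 1 | constructor 2].
Qed.

Lemma decomp_cons p x (s : seq g) : decomp p.+1 (x :: s) = tcons x (decomp p s).
Proof. by case: p => //=; rewrite scale1r. Qed.

#[local] Arguments decomp {g} p s : simpl never.

Lemma multilift_cons (Z : cfiltType) p (f : seq g -> Z) :
  @multilift g Z p.+1 f = tlift (fun x => @multilift g Z p (fun s => f (x :: s))).
Proof. by case: p => //=; apply: funext => x; rewrite scale1r. Qed.

Lemma decomp_ext p (Z : cfiltType) (F G : tpow g p -> Z) : continuous_linear F ->
  continuous_linear G ->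
  (forall s, size s = p -> F (decomp p s) = G (decomp p s)) -> F =1 G.
Proof.
elim: p F G => [|p IHp] F G hF hG FG.
  by apply: tpow0_ext => //; apply: (FG [::]).
apply: tpow_ext => // x; apply: IHp => [||s sz].
- exact: cl_comp (bb_clr (tcons_bb p) x) hF.
- exact: cl_comp (bb_clr (tcons_bb p) x) hG.
by rewrite -decomp_cons; apply: FG; rewrite /= sz.
Qed.

(** Exhibiting one continuous linear map with the values of [f] takes the place of a proof that [f]
    is multilinear and uniformly continuous. *)
Lemma multilift_decomp p (Z : cfiltType) (f : seq g -> Z) (F : tpow g p -> Z) :
  continuous_linear F -> (forall s, size s = p -> f s = F (decomp p s)) ->
  @multilift g Z p f = F.
Proof.
elim: p f F => [|p IHp] f F hF fF; apply: funext => t.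
  rewrite /= fF // -(clZ hF); congr F; exact: mulr1.
have bF : bounded_bilinear (fun x t => F (tcons x t)).
  exact: bb_comp (tcons_bb p) (cl_id _) (cl_id _) hF.
rewrite multilift_cons.
have -> : (fun x => @multilift g Z p (fun s => f (x :: s))) =
    (fun x t => F (tcons x t)).
  apply: funext => x; apply: IHp => [|s sz]; first exact: bb_clr bF x.
  by rewrite fF /= ?sz // -decomp_cons.
apply: tpow_ext => // [|x t']; first exact: tlift_cl.
by rewrite tlift_tcons.
Qed.

Lemma altlift_decomp p (Z : cfiltType) (f : seq g -> Z) (F : tpow g p -> Z) :
  continuous_linear F -> (forall s, size s = p -> f s = F (decomp p s)) ->
  @altlift g Z p f = (fun t => (p`!%:R)^-1 *: F t).
Proof. by move=> hF fF; rewrite /altlift (multilift_decomp hF fF). Qed.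

(* [x] inserted before the factor number [i] *)
Fixpoint tins p (i : nat) (x : g) : tpow g p -> tpow g p.+1 :=
  match p return tpow g p -> tpow g p.+1 with
  | 0 => tcons x
  | q.+1 => if i is j.+1 then tlift (fun y t => tcons y (tins j x t)) else tcons x
  end.

Lemma tins_bb p i : bounded_bilinear (@tins p i).
Proof.
elim: p i => [|p IHp] [|i]; try exact: (tcons_bb 0); first exact: (tcons_bb p.+1).
apply: tlift_bb; apply: tri_swap.
exact: tri_comp (tcons_bb _) (IHp i) (cl_id _).
Qed.

Lemma tins_tcons p i x y (t : tpow g p) :
  tins i.+1 x (tcons y t) = tcons y (tins i x t).
Proof.
rewrite [LHS]tlift_tcons //.
exact: bb_comp (tcons_bb _) (cl_id _) (bb_clr (tins_bb p i) x) (cl_id _).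
Qed.

Lemma tins0 p x (t : tpow g p) : tins 0 x t = tcons x t.
Proof. by case: p t. Qed.

Lemma tins_decomp p i x s : size s = p -> (i <= p)%N ->
  tins i x (decomp p s) = decomp p.+1 (take i s ++ x :: drop i s).
Proof.
elim: p i s => [|p IHp] i s.
  by case: s i => [|//] [|//] _ _; rewrite decomp_cons.
case: s => [//|y s] [sz]; case: i => [|i] ip; first by rewrite tins0 -!decomp_cons.
by rewrite [X in tins _ _ X]decomp_cons tins_tcons IHp //= decomp_cons.
Qed.

Lemma size_permute p (s : 'S_p) (x : seq g) : size (permute s x) = p.
Proof. by rewrite size_map size_enum_ord. Qed.

Lemma nth_permute p (s : 'S_p) (x : seq g) (i : 'I_p) : (permute s x)`_i = x`_(s i).
Proof. by rewrite (nth_map i) ?size_enum_ord // nth_ord_enum. Qed.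

Lemma permuteM p (s t : 'S_p) (x : seq g) :
  permute s (permute t x) = permute (s * t) x.
Proof.
apply: (@eq_from_nth _ 0); rewrite !size_permute // => i ip.
by rewrite -[i]/(val (Ordinal ip)) !nth_permute permM.
Qed.

Lemma permute_lift p (t : 'S_p) i x (s : seq g) :
  permute (lift_perm i ord0 t) (x :: s) =
    take i (permute t s) ++ x :: drop i (permute t s).
Proof.
have szt : size (take i (permute t s)) = i.
  by rewrite size_takel // size_permute -ltnS.
have ip : (i <= p)%N by rewrite -ltnS.
apply: (@eq_from_nth _ 0) => [|j].
  by rewrite size_cat /= szt size_drop !size_permute addnS subnKC.
rewrite size_permute => jp; rewrite -[j]/(val (Ordinal jp)).
move: (Ordinal jp) => {jp} {}j; rewrite nth_permute nth_cat szt.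
case: (unliftP i j) => [k|] -> /=.
  rewrite lift_perm_lift lift0 /=; case: (leqP i k) => ik.
    have -> : bump i k = k.+1 by rewrite /bump ik.
    by rewrite ltnNge leqW //= subSn //= nth_drop subnKC // nth_permute.
  have -> : bump i k = k by rewrite /bump leqNgt ik.
  by rewrite ik nth_take // nth_permute.
by rewrite ltnn subnn lift_perm_id.
Qed.

Lemma lift_perm_bij p :
  bijective (fun it : 'I_p.+1 * 'S_p => lift_perm it.1 ord0 it.2).
Proof.
apply: inj_card_bij; last first.
  by rewrite card_prod card_ord !card_Sn factS.
move=> [i s] [j t] /= st; have ij : i = j.
  apply: (@perm_inj _ (lift_perm i ord0 s)).
  by rewrite {2}st !lift_perm_id.
rewrite -ij in st *; congr (_, _); apply/permP => k.
by have := lift_perm_lift i ord0 s k; rewrite st lift_perm_lift => /lift_inj.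
Qed.

(** A permutation of p + 1 factors permutes the last p of them and inserts the first one at some
    place [i]. Continuity thus reduces to that of [tins]. *)
Lemma perm_act_decomp p (s : 'S_p) :
  continuous_linear (@perm_act g p s) /\
  forall x : seq g, size x = p -> perm_act p s (decomp p x) = decomp p (permute s x).
Proof.
suff [F hF FE] : exists2 F : tpow g p -> tpow g p, continuous_linear F &
    forall x : seq g, size x = p -> F (decomp p x) = decomp p (permute s x).
  have -> : @perm_act g p s = F.
    by apply: multilift_decomp => // x /FE.
  by split.
elim: p s => [|p IHp] s.
  exists id => [|x _]; first exact: cl_id.
  by [].
have [h _ hK] := lift_perm_bij p; have := hK s; move: (h s) => [i t] /= <-.
have [F hF FE] := IHp t.
have tinsF : bounded_bilinear (fun x v => tins i x (F v)).
  exact: bb_comp (tins_bb p i) (cl_id _) hF (cl_id _).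
exists (tlift (fun x v => tins i x (F v))) => [|[//|x y] xy].
  exact: tlift_cl.
have sz : size y = p by case: xy.
rewrite decomp_cons tlift_tcons // FE // permute_lift tins_decomp //.
  by rewrite size_permute.
by rewrite -ltnS.
Qed.

End TensorPowers.

Arguments tcons_bb {g} p.
Arguments tins_bb {g} p i.
Arguments perm_act_decomp {g p} s.
Arguments tcons {g p} x t : simpl never.
Arguments tins {g p} i x t : simpl never.
Arguments tlift {g p Z} f t : simpl never.

(** * Insertion of a factor and antisymmetrization *)

#[local] Arguments decomp {g} p s : simpl never.

Lemma sub_rearrange (V : cfiltType) (a b c d e : V) :
  a - (b - d) - (c - - e) = - (b - (a - c) - (d - e)).
Proof.
by rewrite !(opprB, opprD, opprK) !addrA [LHS](ACl (2*4*1*5*3)).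
Qed.

Section Shuffle.
Variable g : cfiltType.

(* The alternating sum of the insertions of [x]; on alternating tensors, the
   wedge product by [x]. *)
Fixpoint tshuf p (x : g) : tpow g p -> tpow g p.+1 :=
  match p return tpow g p -> tpow g p.+1 with
  | 0 => tcons x
  | q.+1 => tlift (fun y t => tcons x (tcons y t) - tcons y (tshuf x t))
  end.

Lemma tshuf_bb p : bounded_bilinear (@tshuf p).
Proof.
elim: p => [|p IHp]; first exact: (tcons_bb 0).
apply: tlift_bb; apply: tri_add.
  exact: tri_comp (tcons_bb _) (tcons_bb _) (cl_id _).
apply: tri_swap.
exact: tri_comp (tcons_bb _) IHp (cl_opp (cl_id _)).
Qed.

Lemma tshuf_cl {p} x : continuous_linear (@tshuf p x).
Proof. exact: bb_clr (tshuf_bb p) x. Qed.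

Lemma tshuf_cll {p} t : continuous_linear (fun x => @tshuf p x t).
Proof. exact: bb_cll (tshuf_bb p) t. Qed.

Lemma tcons_cl {p} x : continuous_linear (@tcons g p x).
Proof. exact: bb_clr (tcons_bb p) x. Qed.

Lemma tshuf0 x q : @tshuf 0 x q = tcons x q.
Proof. by []. Qed.

Lemma tshuf_tcons p x y t :
  @tshuf p.+1 x (tcons y t) = tcons x (tcons y t) - tcons y (tshuf x t).
Proof.
rewrite [LHS]tlift_tcons //; apply: bb_add.
  exact: (bb_comp (tcons_bb p) (cl_id _) (cl_id _) (tcons_cl (p := p.+1) x)).
exact: bb_comp (tcons_bb p.+1) (cl_id _) (tshuf_cl (p := p) x) (cl_opp (cl_id _)).
Qed.

Lemma tshufE p x t : @tshuf p x t = \sum_(i < p.+1) (-1) ^+ i *: tins i x t.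
Proof.
move: t; elim: p => [|p IHp] t.
  by rewrite big_ord_recl big_ord0 addr0 expr0 scale1r tins0 tshuf0.
move: t; apply: tpow_ext => [||y t]; first exact: tshuf_cl.
  by apply: cl_bigsum => i; apply: cl_scale; apply: bb_clr (tins_bb _ _) _.
rewrite tshuf_tcons big_ord_recl expr0 scale1r tins0; congr (_ + _).
rewrite IHp (cl_sum (tcons_cl y)) -sumrN; apply: eq_bigr => i _.
by rewrite (clZ (tcons_cl y)) lift0 tins_tcons exprS mulN1r scaleNr.
Qed.

(** Graded commutativity of the signed shuffle product. It holds on all tensors, hence can be
    checked on [tcons z t]. *)
Lemma tshuf_anticomm p x y t : @tshuf p.+1 x (tshuf y t) = - tshuf y (tshuf x t).
Proof.
move: t; elim: p => [|p IHp] t.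
  move: t; apply: tpow0_ext.
  - exact: cl_comp (tshuf_cl y) (tshuf_cl x).
  - exact: cl_opp (cl_comp (tshuf_cl x) (tshuf_cl y)).
  by rewrite !tshuf0 !tshuf_tcons !tshuf0 opprB.
move: t; apply: tpow_ext => [||z t].
- exact: cl_comp (tshuf_cl y) (tshuf_cl x).
- exact: cl_opp (cl_comp (tshuf_cl x) (tshuf_cl y)).
rewrite !tshuf_tcons (clB (tshuf_cl x)) (clB (tshuf_cl y)) !tshuf_tcons.
rewrite !(clB (tcons_cl _)) IHp (clN (tcons_cl z)).
exact: sub_rearrange.
Qed.

Lemma perm_act_cl p (s : 'S_p) : continuous_linear (@perm_act g p s).
Proof. exact: (perm_act_decomp s).1. Qed.

Lemma perm_actM p (s r : 'S_p) (t : tpow g p) :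
  perm_act p s (perm_act p r t) = perm_act p (s * r)%g t.
Proof.
move: t; apply: decomp_ext => [||x xp].
- exact: cl_comp (perm_act_cl r) (perm_act_cl s).
- exact: perm_act_cl.
have dE q := (perm_act_decomp (g := g) q).2.
by rewrite !dE ?size_permute // permuteM.
Qed.

Definition asym p (t : tpow g p) : tpow g p :=
  \sum_(s : 'S_p) (-1) ^+ s *: perm_act p s t.

Lemma asym_cl {p} : continuous_linear (@asym p).
Proof. by apply: cl_bigsum => s; apply/cl_scale/perm_act_cl. Qed.

Lemma wedgeE p (x : seq g) : size x = p -> wedge p x = asym (decomp p x).
Proof. by move=> xp; apply: eq_bigr => s _; rewrite (perm_act_decomp (g := g) s).2. Qed.

(** The sum over permutations splits according to the place [i] of the first factor, the sign being
    (-1)^i times that of the permutation of the others. This recursion replaces sums over ['S_p]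
    from here on. *)
Lemma asym_tcons p x (t : tpow g p) : asym (tcons x t) = tshuf x (asym t).
Proof.
move: t; apply: decomp_ext => [||y yp].
- exact: cl_comp (tcons_cl x) asym_cl.
- exact: cl_comp asym_cl (tshuf_cl x).
rewrite -decomp_cons tshufE /asym.
pose F i (s : 'S_p) := let r := lift_perm i ord0 s in
  (-1) ^+ r *: perm_act p.+1 r (decomp p.+1 (x :: y)).
rewrite (reindex _ (onW_bij _ (lift_perm_bij p))) -(pair_bigA _ F).
apply: eq_bigr => i _.
have icl := bb_clr (tins_bb p i) x.
rewrite (cl_sum icl) scaler_sumr; apply: eq_bigr => s _.
rewrite /F (clZ icl) scalerA odd_lift_perm signr_addb addbF signr_odd.
rewrite !(perm_act_decomp (g := g) _).2 ?yp //=; last by rewrite yp.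
by rewrite permute_lift tins_decomp ?size_permute // -ltnS.
Qed.

Lemma perm_act_asym p (s : 'S_p) (t : tpow g p) :
  perm_act p s (asym t) = (-1) ^+ s *: asym t.
Proof.
rewrite (cl_sum (perm_act_cl s)) scaler_sumr.
rewrite [RHS](reindex_inj (mulgI s)) /=; apply: eq_bigr => r _.
by rewrite (clZ (perm_act_cl s)) perm_actM scalerA odd_permM signr_addb signrMK.
Qed.

Definition alt p (t : tpow g p) : tpow g p := (p`!%:R)^-1 *: asym t.

Lemma alt_cl {p} : continuous_linear (@alt p).
Proof. exact/cl_scale/asym_cl. Qed.

Lemma fact_neq0 p : p`!%:R != 0 :> rat.
Proof. by rewrite Num.Theory.pnatr_eq0 -lt0n fact_gt0. Qed.

Lemma perm_act_alt p (s : 'S_p) (t : tpow g p) :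
  perm_act p s (alt t) = (-1) ^+ s *: alt t.
Proof.
by rewrite (clZ (perm_act_cl s)) perm_act_asym !scalerA mulrC.
Qed.

Lemma alt_fix p (t : tpow g p) :
  (forall s : 'S_p, perm_act p s t = (-1) ^+ s *: t) -> alt t = t.
Proof.
move=> tP; rewrite /alt /asym (eq_bigr (fun=> t)) => [|s _].
  by rewrite sumr_const card_Sn -scaler_nat scalerA mulVf ?fact_neq0 // scale1r.
by rewrite tP scalerA -expr2 sqrr_sign scale1r.
Qed.

Lemma alt_id p (t : tpow g p) : alt (alt t) = alt t.
Proof. by apply: alt_fix => s; apply: perm_act_alt. Qed.

Lemma tshuf_alt p x (t : tpow g p) :
  tshuf x (alt t) = p.+1%:R *: alt (tcons x t).
Proof.
rewrite (clZ (tshuf_cl x)) -asym_tcons /alt scalerA factS natrM invfM mulrA.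
by rewrite divff ?mul1r // Num.Theory.pnatr_eq0.
Qed.

Lemma alt_tshuf p x (t : tpow g p) : alt (tshuf x (alt t)) = tshuf x (alt t).
Proof. by rewrite tshuf_alt (clZ alt_cl) alt_id. Qed.

(** The 1/p! of [altlift] is that of [alt], because a wedge is [asym] of a decomposable tensor. In
    this way [boundary], [Gamma] and [codiff] become the projector [alt] followed by a recursively
    defined map. *)
Lemma altlift_wedge p (Z : cfiltType) (f : seq g -> Z) (F : tpow g p -> Z) :
  continuous_linear F -> (forall s, size s = p -> f s = F (wedge p s)) ->
  altlift f = (fun t : tpow g p => F (alt t)).
Proof.
move=> hF fF; rewrite (@altlift_decomp _ _ _ _ (fun t => F (asym t))) => [||s sp].
- by apply: funext => t; rewrite /alt (clZ hF).
- exact: cl_comp asym_cl hF.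
by rewrite fF // wedgeE.
Qed.

Lemma wedge_cons p x (s : seq g) : size s = p ->
  wedge p.+1 (x :: s) = tshuf x (wedge p s).
Proof. by move=> sp; rewrite !wedgeE ?decomp_cons ?asym_tcons //= sp. Qed.

End Shuffle.

Arguments tshuf {g p} x t : simpl never.
Arguments tshuf_bb {g} p.
Arguments asym_cl {g p}.
Arguments alt_cl {g p}.

(** * Brackets and derivations on tensor powers *)

Section Hat.
Variable g : cfiltType.
Implicit Types (x : g) (s : seq g).

Lemma hat_consS p x s om : hat p.+1 (x :: s) [seq j.+1 | j <- om] = x :: hat p s om.
Proof.
rewrite /hat /= -[1%N]addn0 iotaDl; have -> : (0 \in [seq j.+1 | j <- om]) = false.
  by apply/mapP => -[].
rewrite /= filter_map -map_comp; congr (_ :: _).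
congr map; apply: eq_filter => j /=.
by rewrite add1n mem_map // => ? ? [].
Qed.

Lemma hat_cons0 p x s om :
  hat p.+1 (x :: s) (0%N :: [seq j.+1 | j <- om]) = hat p s om.
Proof.
rewrite /hat /= -[1%N]addn0 iotaDl /= filter_map -map_comp.
congr map; apply: eq_filter => j /=.
by rewrite add1n in_cons mem_map // => ? ? [].
Qed.

Lemma hat_nil s : hat (size s) s [::] = s.
Proof.
rewrite /hat; have -> : [seq k <- iota 0 (size s) | k \notin [::]] = iota 0 (size s).
  by apply/all_filterP/allP.
apply: (@eq_from_nth _ 0); rewrite size_map size_iota // => i ip.
by rewrite (nth_map 0%N) ?size_iota // nth_iota.
Qed.

Lemma hat_head p x s : size s = p -> hat p.+1 (x :: s) [:: 0%N] = s.
Proof. by move=> <-; rewrite (hat_cons0 _ x s [::]) hat_nil. Qed.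

Lemma size_hat1 p s j : (j < p.+1)%N -> size (hat p.+1 s [:: j]) = p.
Proof.
move=> jp; rewrite size_map size_filter.
have ur := iota_uniq 0 p.+1; have jr : j \in iota 0 p.+1 by rewrite mem_iota.
have := size_iota 0 p.+1; move: (iota 0 p.+1) ur jr => r ur jr.
rewrite -(count_predC (pred1 j)) count_uniq_mem // jr add1n => -[<-].
by apply: eq_count => k; rewrite inE.
Qed.

Lemma size_hat2 p s i j : (i < j)%N -> (j < p.+2)%N -> size (hat p.+2 s [:: i; j]) = p.
Proof.
move=> ij jp; rewrite size_map size_filter.
have ur := iota_uniq 0 p.+2; have jr : j \in iota 0 p.+2 by rewrite mem_iota.
have ir : i \in iota 0 p.+2 by rewrite mem_iota (ltn_trans ij).
have := size_iota 0 p.+2; move: (iota 0 p.+2) ur ir jr => r ur ir jr.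
rewrite -(count_predC (predU (pred1 i) (pred1 j))).
have -> : count (predU (pred1 i) (pred1 j)) r = 2%N.
  have := count_predUI (pred1 i) (pred1 j) r.
  rewrite !count_uniq_mem // ir jr [X in (_ + X)%N](_ : _ = 0%N) ?addn0 //.
  rewrite -(@count_pred0 _ r); apply: eq_count => k /=.
  by apply/negP => /andP[/eqP -> /eqP ji]; rewrite ji ltnn in ij.
rewrite add2n => -[<-].
by apply: eq_count => k; rewrite !inE.
Qed.

(** Laplace expansion along the first tensor slot. It explains the hats in the definitions: a map
    that acts on the first slot alone yields, on a wedge, the sum over the omitted factor. *)
Lemma wedge_expand p s : size s = p.+1 ->
  wedge p.+1 s =
    \sum_(j < p.+1) (-1) ^+ j *: tcons s`_j (wedge p (hat p.+1 s [:: val j])).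
Proof.
elim: p s => [|p IHp] [|x s] // [sp].
  move: sp => /size0nil ->; rewrite big_ord_recl big_ord0 addr0 expr0 scale1r.
  by rewrite wedge_cons // [hat _ _ _]hat_head.
rewrite wedge_cons // [RHS]big_ord_recl expr0 scale1r.
rewrite (@hat_head p.+1 x s sp) (IHp s sp).
rewrite (cl_sum (tshuf_cl x)) (cl_sum (tcons_cl x)) -big_split /=.
apply: eq_bigr => j _. rewrite (clZ (tshuf_cl x)) tshuf_tcons scalerBr.
have -> : bump 0 j = j.+1 by [].
rewrite (clZ (tcons_cl x)) add0n exprS mulN1r scaleNr.
have -> := hat_consS p.+1 x s [:: val j].
by rewrite wedge_cons ?(size_hat1 s (ltn_ord j)).
Qed.

End Hat.

(** * Bracketing one factor into the others *)

Section Bracket.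
Variables (g : cfiltType) (br : g -> g -> g).
Hypothesis br_bb : bounded_bilinear br.

(* On alternating tensors, the extension of [br x] to a derivation:
   see [ladjoint_asym]. *)
Definition ladjoint p (x : g) : tpow g p.+1 -> tpow g p.+1 :=
  tlift (fun y t => tshuf (br x y) t).

Lemma ladjoint_tri p : bounded_trilinear (fun x y t => @tshuf g p (br x y) t).
Proof.
exact: tri_rot (tri_rot (tri_comp (bb_flip (tshuf_bb p)) br_bb (cl_id _))).
Qed.

Lemma ladjoint_bb p : bounded_bilinear (@ladjoint p).
Proof. exact/tlift_bb/ladjoint_tri. Qed.


Lemma ladjoint_cl {p} x : continuous_linear (@ladjoint p x).
Proof. exact: bb_clr (ladjoint_bb p) x. Qed.

Lemma ladjoint_tcons p x y (t : tpow g p) : ladjoint x (tcons y t) = tshuf (br x y) t.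
Proof. by rewrite [LHS]tlift_tcons //; apply: tri_bb (ladjoint_tri p). Qed.

Lemma ladjoint_tshuf p x y (t : tpow g p.+1) :
  ladjoint x (tshuf y t) = tshuf (br x y) t + tshuf y (ladjoint x t).
Proof.
move: t; apply: tpow_ext => [||z t].
- exact: cl_comp (tshuf_cl y) (ladjoint_cl x).
- by apply: cl_add; [exact: tshuf_cl | exact: cl_comp (ladjoint_cl x) (tshuf_cl y)].
rewrite tshuf_tcons (clB (ladjoint_cl x)) !ladjoint_tcons.
by rewrite tshuf_anticomm opprK.
Qed.

(* Up to normalization, the Chevalley-Eilenberg boundary: see [boundaryE]. *)
Definition contract p : tpow g p.+2 -> tpow g p.+1 := tlift (@ladjoint p).

Lemma contract_cl {p} : continuous_linear (@contract p).
Proof. exact/tlift_cl/ladjoint_bb. Qed.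

Lemma contract_tcons p x (t : tpow g p.+1) : contract (tcons x t) = ladjoint x t.
Proof. by rewrite [LHS]tlift_tcons //; apply: ladjoint_bb. Qed.

Hypothesis br_alt : forall x, br x x = 0.

Lemma br_anti x y : br x y = - br y x.
Proof.
have h1 := bb_cll br_bb; have h2 := bb_clr br_bb.
have := br_alt (x + y); rewrite (clD (h1 _)) !(clD (h2 _)) !br_alt add0r addr0.
by move/eqP; rewrite addr_eq0 => /eqP.
Qed.

(** Apart from [contract_tshuf] because [contract] starts in degree 2: the term
    [tshuf x (contract t)] has no counterpart for [t] of degree 1. *)
Lemma contract_tshuf0 x (t : tpow g 1) : contract (tshuf x t) = 2%:R *: ladjoint x t.
Proof.
have -> : t = tcons (p := 0) (t : g) (1 : rat^o) by rewrite /tcons scale1r.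
rewrite tshuf_tcons tshuf0 (clB contract_cl) !contract_tcons !ladjoint_tcons.
by rewrite (br_anti t x) (clN (tshuf_cll _)) opprK scaler_nat.
Qed.

(** Cartan's formula for [contract]. The vector [x] is met once as the first and once as the second
    member of a pair; antisymmetry makes the two contributions equal, whence the 2. *)
Lemma contract_tshuf p x (t : tpow g p.+2) :
  contract (tshuf x t) = 2%:R *: ladjoint x t - tshuf x (contract t).
Proof.
move: t; apply: tpow_ext => [||y t].
- exact: cl_comp (tshuf_cl x) contract_cl.
- apply: cl_sub; first exact: cl_scale (ladjoint_cl x).
  exact: cl_comp contract_cl (tshuf_cl x).
rewrite tshuf_tcons (clB contract_cl) !contract_tcons ladjoint_tshuf !ladjoint_tcons.
by rewrite (br_anti y x) (clN (tshuf_cll _)) opprD opprK addrA scaler_nat.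
Qed.

End Bracket.

(** * Derivations of the tensor powers induced by an operator on the factors *)

Section Derivation.
Variables (g : cfiltType) (A : g -> g).
Hypothesis A_cl : continuous_linear A.

Fixpoint tder p : tpow g p -> tpow g p :=
  match p return tpow g p -> tpow g p with
  | 0 => fun=> 0
  | q.+1 => tlift (fun x t => tcons (A x) t + tcons x (tder t))
  end.

Lemma tder_bb p : continuous_linear (@tder p) ->
  bounded_bilinear (fun x t => tcons (A x) t + tcons x (@tder p t)).
Proof.
move=> h; apply: bb_add; first exact: bb_comp (tcons_bb p) A_cl (cl_id _) (cl_id _).
exact: bb_comp (tcons_bb p) (cl_id _) h (cl_id _).
Qed.

Lemma tder_cl {p} : continuous_linear (@tder p).
Proof. by elim: p => [|p IHp]; [apply: cl_zero | apply/tlift_cl/tder_bb]. Qed.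

Lemma tder_tcons p x (t : tpow g p) :
  tder (tcons x t) = tcons (A x) t + tcons x (tder t).
Proof. by rewrite [LHS]tlift_tcons //; apply/tder_bb/tder_cl. Qed.

Lemma tder0 (t : tpow g 0) : tder t = 0.
Proof. by []. Qed.

Lemma tder_tshuf p x (t : tpow g p) :
  tder (tshuf x t) = tshuf (A x) t + tshuf x (tder t).
Proof.
move: t; elim: p => [|p IHp] t; first by rewrite !tshuf0 tder_tcons.
move: t; apply: tpow_ext => [||y t].
- exact: cl_comp (tshuf_cl x) tder_cl.
- by apply: cl_add; [exact: tshuf_cl | exact: cl_comp tder_cl (tshuf_cl x)].
rewrite tshuf_tcons (clB tder_cl) !tder_tcons IHp (clD (tshuf_cl x)) !tshuf_tcons.
rewrite !(clD (tcons_cl _)) !opprD !addrA.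
by rewrite [LHS](ACl (1*5*2*4*3*6)).
Qed.

Lemma tder_asym p (t : tpow g p) : tder (asym t) = asym (tder t).
Proof.
move: t; elim: p => [|p IHp] t; first by rewrite !tder0 (cl0 asym_cl).
move: t; apply: tpow_ext => [||x t].
- exact: cl_comp asym_cl tder_cl.
- exact: cl_comp tder_cl asym_cl.
by rewrite tder_tcons (clD asym_cl) !asym_tcons tder_tshuf IHp.
Qed.

Lemma tder_alt p (t : tpow g p) : tder (alt t) = alt (tder t).
Proof. by rewrite (clZ tder_cl) tder_asym. Qed.

Variable br : g -> g -> g.
Hypothesis br_bb : bounded_bilinear br.
Hypothesis A_der : forall x y, A (br x y) = br (A x) y + br x (A y).

Lemma tder_ladjoint p x (t : tpow g p.+1) :
  tder (ladjoint br x t) = ladjoint br (A x) t + ladjoint br x (tder t).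
Proof.
move: t; apply: tpow_ext => [||y t].
- exact: cl_comp (ladjoint_cl br_bb x) tder_cl.
- by apply: cl_add; [exact: ladjoint_cl | exact: cl_comp tder_cl (ladjoint_cl br_bb x)].
rewrite tder_tcons (clD (ladjoint_cl br_bb x)) !ladjoint_tcons // tder_tshuf A_der.
by rewrite (clD (tshuf_cll _)) addrA.
Qed.

Lemma tder_contract p (t : tpow g p.+2) :
  tder (contract br t) = contract br (tder t).
Proof.
move: t; apply: tpow_ext => [||x t].
- exact: cl_comp (contract_cl br_bb) tder_cl.
- exact: cl_comp tder_cl (contract_cl br_bb).
by rewrite tder_tcons (clD (contract_cl br_bb)) !contract_tcons // tder_ladjoint.
Qed.

End Derivation.

(** Both operators satisfy the Leibniz rule for [tshuf], and antisymmetrized tensors are built by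
    iterating [tshuf]. On tensors that are not alternating the two may differ. *)
Lemma ladjoint_asym (g : cfiltType) (br : g -> g -> g) p x (t : tpow g p.+1) :
  bounded_bilinear br -> ladjoint br x (asym t) = tder (br x) (asym t).
Proof.
move=> br_bb; have brx := bb_clr br_bb x.
move: t; elim: p => [|p IHp]; apply: tpow_ext => [||y t];
  try exact: (cl_comp asym_cl (ladjoint_cl br_bb x));
  try exact: (cl_comp asym_cl (tder_cl brx)).
  rewrite asym_tcons tshuf0 ladjoint_tcons // tshuf0 tder_tcons // tder0.
  by rewrite (cl0 (tcons_cl y)) addr0.
by rewrite asym_tcons ladjoint_tshuf // IHp tder_tshuf.
Qed.

(** * Wedge products, codifferentials and functoriality *)

Section WedgeProduct.
Variable g : cfiltType.

Fixpoint tcat p q : tpow g p -> tpow g q -> tpow g (p + q) :=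
  match p return tpow g p -> tpow g q -> tpow g (p + q) with
  | 0 => fun (r : rat^o) t => (r : rat) *: t
  | p'.+1 => fun u t => tlift (fun x v => tcons x (tcat v t)) u
  end.

Lemma tcat_bb p q : bounded_bilinear (@tcat p q).
Proof.
elim: p => [|p IHp].
  apply: bb_intro => [a r r' t|a r t t'|k] /=.
  - by rewrite scalerDl scalerA.
  - by rewrite scalerDr !scalerA mulrC.
  exists k.+1; split=> r t; last by move=> /level_decr; apply: levelZ.
  by case=> // ->; rewrite scale0r; apply: level0.
apply: bb_flip; apply: tlift_bb.
exact: tri_rot (tri_comp (tcons_bb _) IHp (cl_id _)).
Qed.

Lemma tcat_tcons p q x (u : tpow g p) (t : tpow g q) :
  tcat (tcons x u : tpow g p.+1) t = tcons x (tcat u t).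
Proof.
rewrite [LHS]tlift_tcons //.
exact: bb_comp (tcons_bb _) (cl_id _) (bb_cll (tcat_bb p q) t) (cl_id _).
Qed.

Lemma tcat0 q (t : tpow g q) : tcat (p := 0) (1 : rat^o) t = t.
Proof. exact: scale1r. Qed.

Lemma tcat_decomp p q (x y : seq g) : size x = p ->
  tcat (decomp p x) (decomp q y) = decomp (p + q) (x ++ y).
Proof.
elim: p x => [|p IHp] [|a x] // => [_|[xp]]; first exact: tcat0.
by rewrite [X in tcat X]decomp_cons tcat_tcons IHp // -decomp_cons.
Qed.

Lemma wedge_prodE p q (t : tpow g p) (t' : tpow g q) :
  wedge_prod p q t t' =
    (p`!%:R)^-1 *: ((q`!%:R)^-1 *: asym (tcat t t')).
Proof.
have inner (x : seq g) : size x = p ->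
    altlift (fun y => wedge (p + q) (x ++ y)) t' =
    (q`!%:R)^-1 *: asym (tcat (decomp p x) t').
  move=> xp.
  rewrite (@altlift_decomp _ _ _ _ (fun t' => asym (tcat (decomp p x) t'))) //.
    exact: cl_comp (bb_clr (tcat_bb p q) _) asym_cl.
  by move=> y yq; rewrite tcat_decomp // -wedgeE // size_cat xp yq.
rewrite /wedge_prod.
rewrite (@altlift_decomp _ _ _ _ (fun t => (q`!%:R)^-1 *: asym (tcat t t'))) //.
apply: cl_scale; exact: cl_comp (bb_cll (tcat_bb p q) _) asym_cl.
Qed.

Lemma wedge_prod_bb p q : bounded_bilinear (@wedge_prod g p q).
Proof.
apply: bb_eq (bb_comp (tcat_bb p q) (cl_id _) (cl_id _)
  (cl_scale (p`!%:R)^-1 (cl_scale (q`!%:R)^-1 asym_cl))) => t t'.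
by rewrite wedge_prodE.
Qed.

(** The sum over omitted factors is a wedge expanded along its first slot. Positions are counted
    from 1 in the definition and from 0 in [wedge_expand], whence the minus sign. *)
Lemma codiffE (delta : g -> g ⊗ g) q (t : tpow g q.+1) : continuous_linear delta ->
  codiff delta q.+1 t =
    tlift (fun x t => - wedge_prod 2 q (delta x) t : tpow g q.+2) (alt t).
Proof.
move=> dcl; set f := fun x t => _.
have bf : bounded_bilinear f.
  exact: bb_comp (wedge_prod_bb 2 q) dcl (cl_id _) (cl_opp (cl_id _)).
rewrite /codiff (@altlift_wedge _ _ _ _ (tlift f)) //; first exact: tlift_cl.
move=> x xq; rewrite wedge_expand // (cl_sum (tlift_cl bf)).
apply: eq_bigr => i _; rewrite (clZ (tlift_cl bf)) tlift_tcons //.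
by rewrite /f exprS mulN1r scalerN scaleNr.
Qed.

Lemma codiff_cl (delta : g -> g ⊗ g) p : continuous_linear delta ->
  continuous_linear (codiff delta p).
Proof.
move=> dcl; case: p => [|q]; first exact: cl_zero.
have bf : bounded_bilinear (fun x t => - wedge_prod 2 q (delta x) t : tpow g q.+2).
  exact: bb_comp (wedge_prod_bb 2 q) dcl (cl_id _) (cl_opp (cl_id _)).
by apply: cl_eq (cl_comp alt_cl (tlift_cl bf)) => t; rewrite codiffE.
Qed.

End WedgeProduct.

Arguments tcat {g p q} u t : simpl never.

(** * Maps induced on tensor powers and chains, and their compatibility with the codifferentials *)

Section Functoriality.
Variables (g : cfiltType) (U : g -> g).
Hypothesis U_cl : continuous_linear U.

Fixpoint tpmap p : tpow g p -> tpow g p :=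
  match p return tpow g p -> tpow g p with
  | 0 => id
  | q.+1 => tlift (fun x t => tcons (U x) (tpmap t))
  end.

Lemma tpmap_cl {p} : continuous_linear (@tpmap p).
Proof.
elim: p => [|p IHp]; first exact: cl_id.
apply: tlift_cl; exact: bb_comp (tcons_bb p) U_cl IHp (cl_id _).
Qed.

Lemma tpmap_tcons p x (t : tpow g p) : tpmap (tcons x t) = tcons (U x) (tpmap t).
Proof.
rewrite [LHS]tlift_tcons //.
exact: bb_comp (tcons_bb p) U_cl tpmap_cl (cl_id _).
Qed.

Lemma tpmap_tshuf p x (t : tpow g p) : tpmap (tshuf x t) = tshuf (U x) (tpmap t).
Proof.
move: t; elim: p => [|p IHp] t; first exact: tpmap_tcons.
move: t; apply: tpow_ext => [||y t].
- exact: cl_comp (tshuf_cl x) tpmap_cl.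
- exact: cl_comp tpmap_cl (tshuf_cl (U x)).
by rewrite tpmap_tcons !tshuf_tcons (clB tpmap_cl) !tpmap_tcons IHp.
Qed.

Lemma tpmap_asym p (t : tpow g p) : tpmap (asym t) = asym (tpmap t).
Proof.
move: t; elim: p => [|p IHp] t; first by [].
move: t; apply: tpow_ext => [||x t].
- exact: cl_comp asym_cl tpmap_cl.
- exact: cl_comp tpmap_cl asym_cl.
by rewrite tpmap_tcons !asym_tcons tpmap_tshuf IHp.
Qed.

Lemma tpmap_alt p (t : tpow g p) : tpmap (alt t) = alt (tpmap t).
Proof. by rewrite (clZ tpmap_cl) tpmap_asym. Qed.

Lemma tpmap_tcat p q (t : tpow g p) (t' : tpow g q) :
  tpmap (tcat t t') = tcat (tpmap t) (tpmap t').
Proof.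
have tl r t1 := bb_cll (tcat_bb g r q) t1.
move: t; elim: p => [|p IHp] t.
  by rewrite [LHS](clZ tpmap_cl).
move: t; apply: tpow_ext => [||x t].
- exact: cl_comp (tl _ _) tpmap_cl.
- exact: cl_comp tpmap_cl (tl _ _).
by rewrite tpmap_tcons tcat_tcons [LHS]tpmap_tcons tcat_tcons IHp.
Qed.

Lemma tpmap_wedge_prod p q (t : tpow g p) (t' : tpow g q) :
  tpmap (wedge_prod p q t t') = wedge_prod p q (tpmap t) (tpmap t').
Proof. by rewrite !wedge_prodE !(clZ tpmap_cl) tpmap_asym tpmap_tcat. Qed.

Lemma tpmap1 : @tpmap 1 = U.
Proof. by apply: funext => x; rewrite /= /tlift /tcons scale1r. Qed.

Lemma tpmap2 (t : tpow g 2) : tpmap t = tmap U U t.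
Proof.
move: t; apply: tpow_ext => [||x t]; first exact: tpmap_cl.
  exact: tmap_cl.
rewrite tpmap_tcons [RHS]tmap_pure //; congr (_ ⊗ _).
by rewrite tpmap1.
Qed.

Variables (delta delta' : g -> g ⊗ g).
Hypotheses (delta_cl : continuous_linear delta) (delta'_cl : continuous_linear delta').
Hypothesis deltaU : forall x, delta' (U x) = tmap U U (delta x).

Lemma tpmap_codiff p (t : tpow g p) :
  tpmap (codiff delta p t) = codiff delta' p (tpmap t).
Proof.
case: p t => [|q] t; first exact: (cl0 tpmap_cl).
rewrite !codiffE // -tpmap_alt; move: (alt t) => {}t.
have bb (d : g -> g ⊗ g) : continuous_linear d ->
    bounded_bilinear (fun x t => - wedge_prod 2 q (d x) t : tpow g q.+2).
  by move=> dcl; exact: bb_comp (wedge_prod_bb g 2 q) dcl (cl_id _) (cl_opp (cl_id _)).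
have [b b'] := (bb _ delta_cl, bb _ delta'_cl).
move: t; apply: tpow_ext => [||x t].
- exact: cl_comp (tlift_cl b) tpmap_cl.
- exact: cl_comp tpmap_cl (tlift_cl b').
rewrite tpmap_tcons !tlift_tcons // (clN tpmap_cl) deltaU -tpmap2.
by congr (- _); exact: (@tpmap_wedge_prod 2 q (delta x) t).
Qed.

Variables (M : cfiltType) (UM : M -> M) (mu mu' : M -> M ⊗ g).
Hypotheses (UM_cl : continuous_linear UM).
Hypotheses (mu_cl : continuous_linear mu) (mu'_cl : continuous_linear mu').
Hypothesis muU : forall m, mu' (UM m) = tmap UM U (mu m).

Definition mmap p : M ⊗ tpow g p -> M ⊗ tpow g p := tmap UM (@tpmap p).

Lemma mmap_cl {p} : continuous_linear (@mmap p).
Proof. exact: tmap_cl UM_cl tpmap_cl. Qed.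

Lemma mmap_pure p m (t : tpow g p) : mmap (m ⊗ t) = UM m ⊗ tpmap t.
Proof. exact: tmap_pure UM_cl tpmap_cl m t. Qed.

Lemma wedgeM_tri p q :
  bounded_trilinear (fun eta (m : M) xi =>
    m ⊗ wedge_prod p q xi eta : M ⊗ tpow g (p + q)).
Proof. exact: tri_rot (tri_comp (pure_bb _ _) (wedge_prod_bb g p q) (cl_id _)). Qed.

Lemma wedgeM_bb p q : bounded_bilinear (@wedgeM g M p q).
Proof. exact: bb_flip (bilift_bb (wedgeM_tri p q)). Qed.

Lemma wedgeM_pure p q (m : M) (xi : tpow g p) (eta : tpow g q) :
  wedgeM g M p q (m ⊗ xi) eta = m ⊗ wedge_prod p q xi eta.
Proof. by rewrite /wedgeM bilift_pure //; apply: tri_bb (wedgeM_tri p q). Qed.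

Lemma mmap_wedgeM p q (u : M ⊗ tpow g p) (eta : tpow g q) :
  mmap (wedgeM g M p q u eta) = wedgeM g M p q (mmap u) (tpmap eta).
Proof.
have wcl e := bb_cll (wedgeM_bb p q) e.
move: u; apply: tensor_eq => [||m xi].
- exact: cl_comp (wcl _) mmap_cl.
- exact: cl_comp mmap_cl (wcl _).
by rewrite mmap_pure !wedgeM_pure mmap_pure tpmap_wedge_prod.
Qed.

Lemma codiffM_bb (delta0 : g -> g ⊗ g) (mu0 : M -> M ⊗ g) p :
  continuous_linear delta0 -> continuous_linear mu0 ->
  bounded_bilinear (fun (m : M) xi => wedgeM g M 1 p (mu0 m) xi +
    m ⊗ codiff delta0 p xi : M ⊗ tpow g p.+1).
Proof.
move=> dcl mcl; apply: bb_add.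
  exact: bb_comp (wedgeM_bb 1 p) mcl (cl_id _) (cl_id _).
exact: bb_comp (pure_bb _ _) (cl_id _) (codiff_cl p dcl) (cl_id _).
Qed.

Lemma codiffM_pure (delta0 : g -> g ⊗ g) (mu0 : M -> M ⊗ g) p m (xi : tpow g p) :
  continuous_linear delta0 -> continuous_linear mu0 ->
  codiffM g M delta0 mu0 p (m ⊗ xi) =
    wedgeM g M 1 p (mu0 m) xi + m ⊗ codiff delta0 p xi.
Proof. by move=> dcl mcl; exact: bilift_pure (codiffM_bb p dcl mcl) m xi. Qed.

Lemma mmap_codiffM p (u : M ⊗ tpow g p) :
  mmap (codiffM g M delta mu p u) = codiffM g M delta' mu' p (mmap u).
Proof.
have b := codiffM_bb p delta_cl mu_cl; have b' := codiffM_bb p delta'_cl mu'_cl.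
move: u; apply: tensor_eq => [||m xi].
- exact: cl_comp (bilift_cl b) mmap_cl.
- exact: cl_comp mmap_cl (bilift_cl b').
rewrite mmap_pure !codiffM_pure // (clD mmap_cl) mmap_pure tpmap_codiff muU.
have -> : tmap UM U (mu m) = mmap (p := 1) (mu m) by rewrite /mmap tpmap1.
by rewrite -(@mmap_wedgeM 1 p (mu m) xi).
Qed.

End Functoriality.

(** * The boundary *)

Lemma sum_gt0_lift (V : cfiltType) n (F : 'I_n.+1 -> V) :
  \sum_(j < n.+1 | (@ord0 n < j)%N) F j = \sum_(j < n) F (lift ord0 j).
Proof. by rewrite big_mkcond big_ord_recl /= add0r. Qed.

Lemma sum_gt_lift (V : cfiltType) n (i : 'I_n) (F : 'I_n.+1 -> V) :
  \sum_(j < n.+1 | (lift ord0 i < j)%N) F j = \sum_(j < n | (i < j)%N) F (lift ord0 j).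
Proof.
rewrite big_mkcond big_ord_recl /= add0r [RHS]big_mkcond.
by apply: eq_bigr => j _; rewrite /bump !add1n ltnS.
Qed.

Section LieBracket.
Variables (g : cfiltType) (nabla : g ⊗ g -> g).
Hypothesis hg : is_lie_algebra nabla.
Let br x y := nabla (x ⊗ y).

Lemma nabla_bb : bounded_bilinear br.
Proof. exact: bb_comp (pure_bb _ _) (cl_id _) (cl_id _) (nabla_cl _ _ hg). Qed.

Lemma ad_cl x : continuous_linear (ad nabla x).
Proof. exact: bb_clr nabla_bb x. Qed.

Lemma ad_derivation X x y : br X (br x y) = br (br X x) y + br x (br X y).
Proof.
have h1 := bb_cll nabla_bb; have h2 := bb_clr nabla_bb.
have anti := br_anti nabla_bb (nabla_alt _ _ hg).
have jac : br X (br x y) + br x (br y X) + br y (br X x) = 0.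
  exact: nabla_jacobi.
move/eqP: jac.
rewrite -addrA addr_eq0 => /eqP ->; rewrite opprD addrC; congr (_ + _).
  by rewrite -anti.
by rewrite (anti X y) (clN (h2 x)).
Qed.

(** The pairs that contain the first position are the expansion of the wedge of [s] under
    [ladjoint br x]. In the other pairs the two index shifts cancel in the sign, and moving [x] in
    front of the bracket costs one sign by [tshuf_anticomm]. *)
Lemma boundary_sum_cons p x (s : seq g) : size s = p.+1 ->
  \sum_(i < p.+2) \sum_(j < p.+2 | (i < j)%N) (-1) ^+ (i.+1 + j.+1) *:
    wedge p.+1 (br (x :: s)`_i (x :: s)`_j :: hat p.+2 (x :: s) [:: val i; val j]) =
  - ladjoint br x (wedge p.+1 s) -
  tshuf x (\sum_(i < p.+1) \sum_(j < p.+1 | (i < j)%N) (-1) ^+ (i.+1 + j.+1) *: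
    wedge p (br s`_i s`_j :: hat p.+1 s [:: val i; val j])).
Proof.
move=> sp; rewrite big_ord_recl; congr (_ + _).
  rewrite sum_gt0_lift.
  have lcl := ladjoint_cl nabla_bb (p := p) x.
  rewrite wedge_expand // (cl_sum lcl) -sumrN; apply: eq_bigr => j _.
  rewrite (clZ lcl) (ladjoint_tcons nabla_bb) /=.
  have -> : bump 0 j = j.+1 by [].
  have -> := hat_cons0 p.+1 x s [:: val j].
  rewrite wedge_cons ?(size_hat1 s (ltn_ord j)) //.
  by rewrite add0n !addSn add0n 3!exprS !mulN1r opprK scaleNr.
rewrite (cl_sum (tshuf_cl x)) -sumrN; apply: eq_bigr => i _.
rewrite (cl_sum (tshuf_cl x)) -sumrN sum_gt_lift; apply: eq_bigr => j ij /=.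
rewrite /bump !leq0n !add1n.
have -> := hat_consS p.+1 x s [:: val i; val j].
have -> : (-1) ^+ (i.+2 + j.+2) = (-1) ^+ (i.+1 + j.+1) :> rat.
  by rewrite !addSn !addnS -signr_odd -[RHS]signr_odd /= !negbK.
rewrite (clZ (tshuf_cl x)) -scalerN; congr (_ *: _).
case: p sp i j ij => [|p] sp i j ij.
  by case: i j ij => [[|//] ?] [[|//] ?].
have sh := size_hat2 s ij (ltn_ord j).
set h := hat p.+2 s _ in sh *.
have xh : size (x :: h) = p.+1 by rewrite /= sh.
by rewrite (wedge_cons _ xh) !(wedge_cons _ sh) tshuf_anticomm.
Qed.


Lemma boundary0 (t : tpow g 0) : boundary nabla 0 t = 0.
Proof.
rewrite /boundary (@altlift_decomp _ _ _ _ (fun=> 0)) ?scaler0 // => [|s _].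
  exact: cl_zero.
by rewrite big_ord0.
Qed.

Lemma boundary1 (t : tpow g 1) : boundary nabla 1 t = 0.
Proof.
rewrite /boundary (@altlift_decomp _ _ _ _ (fun=> 0)) ?scaler0 // => [|s _].
  exact: cl_zero.
by rewrite big1 // => i _; rewrite big1 // => j; rewrite (ord1 i) (ord1 j).
Qed.

(** Both sides obey the same recursion, by [boundary_sum_cons] and [contract_tshuf]; 1/2 turns
    ordered pairs into pairs i < j. *)
Lemma boundary_sumE p (s : seq g) : size s = p.+2 ->
  \sum_(i < p.+2) \sum_(j < p.+2 | (i < j)%N) (-1) ^+ (i.+1 + j.+1) *:
    wedge p.+1 (br s`_i s`_j :: hat p.+2 s [:: val i; val j]) =
  - 2%:R^-1 *: contract br (wedge p.+2 s).
Proof.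
have half (V : cfiltType) (u : V) : u = 2%:R^-1 *: (2%:R *: u).
  by rewrite scalerA mulVf // scale1r.
elim: p s => [|p IHp] [|x s] // [sp]; rewrite boundary_sum_cons // wedge_cons //.
  rewrite contract_tshuf0 //; [|exact: nabla_bb|exact: nabla_alt].
  rewrite scaleNr -half big1 => [|i _]; last first.
    by rewrite big1 // => j; rewrite (ord1 i) (ord1 j).
  by rewrite (cl0 (tshuf_cl x)) subr0.
rewrite IHp // contract_tshuf //; [|exact: nabla_bb|exact: nabla_alt].
by rewrite (clZ (tshuf_cl x)) scalerBr !scaleNr -half.
Qed.

Lemma boundaryE p (t : tpow g p.+2) :
  boundary nabla p.+2 t = - 2%:R^-1 *: contract br (alt t).
Proof.
rewrite /boundary (@altlift_wedge _ _ _ _ (fun t => - 2%:R^-1 *: contract br t)) //.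
  exact/cl_scale/contract_cl/nabla_bb.
by move=> s sp; rewrite -boundary_sumE.
Qed.

Lemma boundary_cl p : continuous_linear (boundary nabla p).
Proof.
case: p => [|[|p]].
- by apply: cl_eq (cl_zero _ _) => t; rewrite boundary0.
- by apply: cl_eq (cl_zero _ _) => t; rewrite boundary1.
apply: cl_eq (cl_comp alt_cl (cl_scale (- 2%:R^-1) (contract_cl nabla_bb))) => t.
by rewrite boundaryE.
Qed.

End LieBracket.

(** * The boundary with coefficients in the module *)

Section ModuleBoundary.
Variables (g M : cfiltType) (nabla : g ⊗ g -> g) (act : g ⊗ M -> M).
Hypotheses (hg : is_lie_algebra nabla) (hM : is_module g M nabla act).
Let br x y := nabla (x ⊗ y).
Let br_bb : bounded_bilinear br := nabla_bb hg.

Lemma act_bb : bounded_bilinear (fun x m => act (x ⊗ m)).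
Proof. exact: bb_comp (pure_bb _ _) (cl_id _) (cl_id _) (act_cl _ _ _ _ hM). Qed.

Lemma mcontr_tri p : bounded_trilinear
  (fun m x t => act (x ⊗ m) ⊗ t : M ⊗ tpow g p).
Proof.
have := tri_comp (bb_flip (pure_bb M (tpow g p))) (bb_flip act_bb) (cl_id _).
by move=> /tri_rot/tri_rot.
Qed.

(** On alternating tensors this is [Gamma] up to sign: see [GammaE]. *)
Definition mcontr p : M ⊗ tpow g p.+1 -> M ⊗ tpow g p :=
  bilift (fun m => tlift (fun x t => act (x ⊗ m) ⊗ t)).

Lemma mcontr_cl {p} : continuous_linear (@mcontr p).
Proof. exact/bilift_cl/tlift_bb/mcontr_tri. Qed.

Lemma mcontr_tcons p m x (t : tpow g p) : mcontr (m ⊗ tcons x t) = act (x ⊗ m) ⊗ t.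
Proof.
rewrite [LHS](bilift_pure (tlift_bb (mcontr_tri p)) m) tlift_tcons //.
exact: tri_bb (mcontr_tri p).
Qed.

Lemma Gamma0 u : Gamma g M act 0 u = 0.
Proof.
move: u; have -> : Gamma g M act 0 = bilift (fun _ _ => 0).
  rewrite /Gamma; congr bilift; apply: funext => m.
  rewrite (@altlift_decomp _ _ _ _ (fun=> 0)) => [||s _].
  - by apply: funext => t; rewrite scaler0.
  - exact: cl_zero.
  by rewrite big_ord0.
have b0 : bounded_bilinear (fun (_ : M) (_ : tpow g 0) => 0 : M ⊗ tpow g 0).
  apply: bb_intro => [a v v' w|a v w w'|k].
  - by rewrite scaler0 addr0.
  - by rewrite scaler0 addr0.
  by exists 0%N; split=> *; apply: level0.
apply: tensor_eq => [||v w]; [exact: bilift_cl | exact: cl_zero |].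
exact: bilift_pure.
Qed.

Lemma Gamma_bb p : bounded_bilinear (fun m t => - mcontr (m ⊗ alt t) : M ⊗ tpow g p).
Proof.
exact: bb_comp (pure_bb _ _) (cl_id _) (alt_cl (p := p.+1)) (cl_opp mcontr_cl).
Qed.

Lemma GammaE p : Gamma g M act p.+1 = bilift (fun m t => - mcontr (m ⊗ alt t)).
Proof.
rewrite /Gamma; congr bilift; apply: funext => m.
rewrite (@altlift_wedge _ _ _ _ (fun t => - mcontr (m ⊗ t))) // => [|s sp].
  exact: cl_comp (pure_cl _ m) (cl_opp mcontr_cl).
rewrite wedge_expand // (cl_sum (pure_cl _ m)) (cl_sum mcontr_cl) -sumrN.
apply: eq_bigr => i _; rewrite (clZ (pure_cl _ m)) (clZ mcontr_cl) mcontr_tcons.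
by rewrite exprS mulN1r scaleNr.
Qed.

Lemma Gamma_cl p : continuous_linear (Gamma g M act p).
Proof.
case: p => [|p]; first by apply: cl_eq (cl_zero _ _) => u; rewrite Gamma0.
by rewrite GammaE; exact/bilift_cl/Gamma_bb.
Qed.

Lemma boundaryM_bb p : bounded_bilinear (fun m xi =>
  Gamma g M act p (m ⊗ xi) + m ⊗ boundary nabla p xi).
Proof.
apply: bb_add; first exact: bb_comp (pure_bb _ _) (cl_id _) (cl_id _) (Gamma_cl p).
exact: bb_comp (pure_bb _ _) (cl_id _) (boundary_cl hg p) (cl_id _).
Qed.

Lemma boundaryM_cl p : continuous_linear (boundaryM g M nabla act p).
Proof. exact: bilift_cl (boundaryM_bb p). Qed.

Lemma boundaryM_pure p m xi : boundaryM g M nabla act p (m ⊗ xi) =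
  Gamma g M act p (m ⊗ xi) + m ⊗ boundary nabla p xi.
Proof. exact: bilift_pure (boundaryM_bb p) m xi. Qed.

Lemma boundaryM0 u : boundaryM g M nabla act 0 u = 0.
Proof.
move: u; apply: tensor_eq => [||m xi]; [exact: boundaryM_cl | exact: cl_zero |].
by rewrite boundaryM_pure Gamma0 boundary0 (cl0 (pure_cl _ m)) addr0.
Qed.

Lemma boundaryM1 m xi : boundaryM g M nabla act 1 (m ⊗ xi) = - mcontr (m ⊗ alt xi).
Proof.
rewrite boundaryM_pure GammaE (bilift_pure (Gamma_bb 0) m xi) boundary1.
by rewrite (cl0 (pure_cl _ m)) addr0.
Qed.

Lemma boundaryM2 p m xi : boundaryM g M nabla act p.+2 (m ⊗ xi) =
  - mcontr (m ⊗ alt xi) - 2%:R^-1 *: (m ⊗ contract br (alt xi)).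
Proof.
rewrite boundaryM_pure GammaE (bilift_pure (Gamma_bb p.+1) m xi) boundaryE //.
rewrite scaleNr (clN (pure_cl _ m)); congr (_ - _); exact: clZ (pure_cl _ m) _ _.
Qed.

End ModuleBoundary.

(** * Cartan's homotopy formula *)

Section Chains.
Variables g M : cfiltType.

Definition malt p : M ⊗ tpow g p -> M ⊗ tpow g p := tmap id (@alt g p).

Lemma malt_cl {p} : continuous_linear (@malt p).
Proof. exact: tmap_cl (cl_id M) alt_cl. Qed.

Lemma malt_pure p m (t : tpow g p) : malt (m ⊗ t) = m ⊗ alt t.
Proof. exact: tmap_pure (cl_id M) alt_cl m t. Qed.

Lemma mperm_cl p (s : 'S_p) :
  continuous_linear (tmap id (perm_act p s) : M ⊗ tpow g p -> M ⊗ tpow g p).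
Proof. exact: tmap_cl (cl_id M) (perm_act_cl g s). Qed.

Lemma chainsP p (u : M ⊗ tpow g p) : chains g M p u <-> malt u = u.
Proof.
split=> [uc|<- s]; last first.
  move: u; apply: tensor_eq => [||m t].
  - exact: cl_comp malt_cl (mperm_cl s).
  - exact: cl_scale malt_cl.
  rewrite malt_pure (tmap_pure (cl_id M) (perm_act_cl g s)) perm_act_alt.
  exact: clZ (pure_cl _ m) _ _.
have -> : malt u =
    (p`!%:R)^-1 *: (\sum_(s : 'S_p) (-1) ^+ s *: tmap id (perm_act p s) u).
  move: {uc} u; apply: tensor_eq => [||m t]; first exact: malt_cl.
    by apply/cl_scale/cl_bigsum => s; apply/cl_scale/mperm_cl.
  rewrite malt_pure /alt (clZ (pure_cl _ m)) (cl_sum (pure_cl _ m)).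
  congr (_ *: _); apply: eq_bigr => s _.
  by rewrite (clZ (pure_cl _ m)) (tmap_pure (cl_id M) (perm_act_cl g s)).
rewrite (eq_bigr (fun=> u)) => [|s _]; last first.
  by rewrite uc scalerA -expr2 sqrr_sign scale1r.
by rewrite sumr_const card_Sn -scaler_nat scalerA mulVf ?fact_neq0 // scale1r.
Qed.

Definition mshuf p x : M ⊗ tpow g p -> M ⊗ tpow g p.+1 := tmap id (@tshuf g p x).

Lemma mshuf_cl {p} x : continuous_linear (@mshuf p x).
Proof. exact: tmap_cl (cl_id M) (tshuf_cl x). Qed.

Lemma mshuf_pure p x m (t : tpow g p) : mshuf x (m ⊗ t) = m ⊗ tshuf x t.
Proof. exact: tmap_pure (cl_id M) (tshuf_cl x) m t. Qed.

Lemma malt_mshuf p x (u : M ⊗ tpow g p) : malt (mshuf x (malt u)) = mshuf x (malt u).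
Proof.
move: u; apply: tensor_eq => [||m t].
- exact: cl_comp (cl_comp malt_cl (mshuf_cl x)) malt_cl.
- exact: cl_comp malt_cl (mshuf_cl x).
by rewrite malt_pure mshuf_pure malt_pure alt_tshuf.
Qed.

End Chains.

Arguments malt_cl {g M p}.
Arguments mshuf_cl {g} M {p} x.

Section Homotopy.
Variables (g M : cfiltType) (nabla : g ⊗ g -> g) (act : g ⊗ M -> M).
Hypotheses (hg : is_lie_algebra nabla) (hM : is_module g M nabla act).
Variable X : g.
Let br x y := nabla (x ⊗ y).
Let br_bb : bounded_bilinear br := nabla_bb hg.
Let ad_X_cl : continuous_linear (br X) := ad_cl hg X.
Local Notation bd := (boundaryM g M nabla act).
Local Notation C := (mcontr act).

(** The diagonal action of [X], defined factor by factor on all tensors: this is the form whose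
    exponential is computed in [expmap_chains]. *)
Definition mder p : M ⊗ tpow g p -> M ⊗ tpow g p :=
  bilift (fun m t => act (X ⊗ m) ⊗ t + m ⊗ tder (ad nabla X) t).

Lemma mder_bb p : bounded_bilinear (fun m (t : tpow g p) =>
  act (X ⊗ m) ⊗ t + m ⊗ tder (ad nabla X) t).
Proof.
apply: bb_add.
  exact: bb_comp (pure_bb _ _) (bb_clr (act_bb hM) X) (cl_id _) (cl_id _).
exact: bb_comp (pure_bb _ _) (cl_id _) (tder_cl ad_X_cl) (cl_id _).
Qed.

Lemma mder_cl {p} : continuous_linear (@mder p).
Proof. exact: bilift_cl (mder_bb p). Qed.

Lemma mder_pure p m (t : tpow g p) :
  mder (m ⊗ t) = act (X ⊗ m) ⊗ t + m ⊗ tder (ad nabla X) t.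
Proof. exact: bilift_pure (mder_bb p) m t. Qed.

Lemma mder_malt p (u : M ⊗ tpow g p) : mder (malt u) = malt (mder u).
Proof.
move: u; apply: tensor_eq => [||m t].
- exact: cl_comp malt_cl mder_cl.
- exact: cl_comp mder_cl malt_cl.
by rewrite malt_pure !mder_pure (clD malt_cl) !malt_pure tder_alt.
Qed.

Lemma mder_mcontr p (u : M ⊗ tpow g p.+1) : mder (C u) = C (mder u).
Proof.
have Ccl := mcontr_cl hM (p := p).
move: u; apply: tensor_eq => [||m t].
- exact: cl_comp Ccl mder_cl.
- exact: cl_comp mder_cl Ccl.
move: t; apply: tpow_ext => [||x t].
- exact: cl_comp (cl_comp (pure_cl _ m) Ccl) mder_cl.
- exact: cl_comp (cl_comp (pure_cl _ m) mder_cl) Ccl.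
rewrite (mcontr_tcons hM) !mder_pure tder_tcons // (clD (pure_cl _ m)) !(clD Ccl).
rewrite !(mcontr_tcons hM) addrA; congr (_ + _).
rewrite -(clD (pure_cll _ t)); congr (_ ⊗ _).
by rewrite /ad (act_bracket _ _ _ _ hM) addrC subrK.
Qed.

Lemma mder_boundaryM p (u : M ⊗ tpow g p) : mder (bd p u) = bd p (mder u).
Proof.
have bdcl q := boundaryM_cl hg hM q.
(* The boundary is 0 in degree 0, has only its action term in degree 1, and involves [contract] from
   degree 2 on. *)
case: p u => [|[|p]] u.
- by rewrite !(boundaryM0 hg hM) (cl0 mder_cl).
- move: u; apply: tensor_eq => [||m t].
  + exact: cl_comp (bdcl 1%N) mder_cl.
  + exact: cl_comp mder_cl (bdcl 1%N).
  rewrite (boundaryM1 hg hM) (clN mder_cl) mder_mcontr !mder_pure (clD (bdcl 1%N)).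
  by rewrite !(boundaryM1 hg hM) (clD (mcontr_cl hM)) opprD tder_alt.
move: u; apply: tensor_eq => [||m t].
+ exact: cl_comp (bdcl p.+2) mder_cl.
+ exact: cl_comp mder_cl (bdcl p.+2).
rewrite mder_pure (clD (bdcl p.+2)) !(boundaryM2 hg hM) (clB mder_cl).
rewrite (clN mder_cl) mder_mcontr (clZ mder_cl) !mder_pure (clD (mcontr_cl hM)).
rewrite tder_contract //; last exact: ad_derivation.
by rewrite tder_alt // scalerDr !opprD addrACA.
Qed.


Lemma mcontr_mshuf p m (t : tpow g p.+1) :
  C (m ⊗ tshuf X t) = act (X ⊗ m) ⊗ t - mshuf X (C (m ⊗ t)).
Proof.
have Ccl q := mcontr_cl hM (p := q).
move: t; apply: tpow_ext => [||x t].
- exact: cl_comp (cl_comp (tshuf_cl X) (pure_cl _ m)) (Ccl _).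
- apply: cl_sub; first exact: pure_cl.
  exact: cl_comp (cl_comp (pure_cl _ m) (Ccl _)) (mshuf_cl M X).
rewrite tshuf_tcons (clB (pure_cl _ m)) (clB (Ccl _)) !(mcontr_tcons hM).
by rewrite mshuf_pure.
Qed.

Lemma ladjoint_alt p (t : tpow g p.+1) :
  ladjoint br X (alt t) = tder (ad nabla X) (alt t).
Proof.
by rewrite /alt (clZ (ladjoint_cl br_bb X)) (clZ (tder_cl ad_X_cl)) ladjoint_asym.
Qed.

Lemma boundaryM_mshuf0 (u : M ⊗ tpow g 0) :
  bd 1 (mshuf X (malt u)) = - mder (malt u).
Proof.
move: u; apply: tensor_eq => [||m t].
- exact: cl_comp (cl_comp malt_cl (mshuf_cl M X)) (boundaryM_cl hg hM 1).
- exact: cl_opp (cl_comp malt_cl mder_cl).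
rewrite malt_pure mshuf_pure (boundaryM1 hg hM) alt_tshuf tshuf0 (mcontr_tcons hM).
by rewrite mder_pure tder0 (cl0 (pure_cl _ m)) addr0.
Qed.

(** The two parts of the boundary give the two parts of the diagonal action: [mcontr_mshuf] the
    action on [m], [contract_tshuf] the action on the factors, since [ladjoint] is [tder] on
    alternating tensors. The 1/2 of [boundaryM2] cancels the 2 of [contract_tshuf]. *)
Lemma boundaryM_mshuf p (u : M ⊗ tpow g p.+1) :
  bd p.+2 (mshuf X (malt u)) = - mder (malt u) - mshuf X (bd p.+1 (malt u)).
Proof.
have half (u' : M ⊗ tpow g p.+1) : 2%:R^-1 *: (2%:R *: u') = u'.
  by rewrite scalerA mulVf // scale1r.
have bdcl q := boundaryM_cl hg hM q.
move: u; apply: tensor_eq => [||m t].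
- exact: cl_comp (cl_comp malt_cl (mshuf_cl M X)) (bdcl p.+2).
- apply: cl_sub; first exact: cl_opp (cl_comp malt_cl mder_cl).
  exact: cl_comp (cl_comp malt_cl (bdcl p.+1)) (mshuf_cl M X).
rewrite malt_pure mshuf_pure (boundaryM2 hg hM) alt_tshuf mcontr_mshuf mder_pure.
case: p t half => [|p] t half.
  rewrite contract_tshuf0 //; last exact: nabla_alt.
  rewrite (clZ (pure_cl _ m)) half ladjoint_alt (boundaryM1 hg hM) alt_id.
  by rewrite (clN (mshuf_cl M X)) !(opprB, opprD, opprK) [LHS](ACl (2*3*1)).
rewrite contract_tshuf //; last exact: nabla_alt.
rewrite (clB (pure_cl _ m)) (clZ (pure_cl _ m)) scalerBr half ladjoint_alt.
rewrite (boundaryM2 hg hM) alt_id (clB (mshuf_cl M X)) (clN (mshuf_cl M X)).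
rewrite (clZ (mshuf_cl M X)) mshuf_pure.
by rewrite !(opprB, opprD, opprK) ?addrA [LHS](ACl (2*4*3*1)).
Qed.

Lemma boundaryM_homotopy p (u : M ⊗ tpow g p) : malt u = u -> bd p u = 0 ->
  bd p.+1 (mshuf X u) = - mder u.
Proof.
move=> uc; case: p u uc => [|p] u uc bu; rewrite -{1}uc.
  by rewrite boundaryM_mshuf0 uc.
by rewrite boundaryM_mshuf uc bu (cl0 (mshuf_cl M X)) subr0.
Qed.

End Homotopy.

(** * Exponentials *)

Definition equicontinuous_iterates (V : cfiltType) (A : V -> V) :=
  forall n, exists m, forall k x, fil m x -> fil n (iter k A x).

Lemma cl_iter (V : cfiltType) (A : V -> V) k :
  continuous_linear A -> continuous_linear (iter k A).
Proof.
by move=> hA; elim: k => [|k IHk]; [apply: cl_id | exact: cl_comp IHk hA].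
Qed.

Section UniformBoundedness.
Variables (V : cfiltType) (A : V -> V).
Hypothesis A_cl : continuous_linear A.
Hypothesis A_vanishing : forall x, vanishing (fun k => iter k A x).

Lemma iterates_fil K n :
  exists m, forall k, (k < K)%N -> forall x, fil m x -> fil n (iter k A x).
Proof.
elim: K => [|K [m mP]]; first by exists 0%N.
have [l lP] := (cl_iter K A_cl).2 n.
exists (maxn m l) => k; rewrite ltnS leq_eqVlt => /predU1P[->|kK] x xP.
  exact/lP/(fil_le _ xP)/leq_maxr.
by apply: mP => //; apply: (fil_le _ xP); apply: leq_maxl.
Qed.

(* Gliding hump: otherwise some [x] would have iterates of arbitrarily large
   order outside [fil n]. *)
Lemma iterates_equicontinuous : equicontinuous_iterates A.
Proof.
move=> n; apply: contrapT => nP.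
have itL k := cl_iter k A_cl.
have hump K m : exists k x, [/\ (K <= k)%N, fil m x & ~ fil n (iter k A x)].
  have [l lP] := iterates_fil K n.
  apply: contrapT => H; apply: nP; exists (maxn m l) => k x xP.
  apply: contrapT => kx; apply: H; exists k, x; split=> //; last first.
    by apply: (fil_le _ xP); apply: leq_maxl.
  rewrite leqNgt; apply/negP => /lP kP; apply: kx; apply: kP.
  exact: fil_le (leq_maxr _ _) xP.
(* A state [(j, (y, m))] stands for the ball [y + fil m]. The next ball lies inside it, and some
   iterate of order at least [j] sends no point of the next ball into [fil n]. *)
have step (jym : nat * (V * nat)) : exists ym : V * nat,
    [/\ fil jym.2.2 (ym.1 - jym.2.1), (jym.2.2 < ym.2)%N &
      exists k, (jym.1 <= k)%N /\
        forall z, fil ym.2 (z - ym.1) -> ~ fil n (iter k A z)].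
  case: jym => j [y m] /=.
  suff [k [y' [jk yy' ky']]] : exists k y',
      [/\ (j <= k)%N, fil m (y' - y) & ~ fil n (iter k A y')].
    have [l lP] := (itL k).2 n.
    (* [m.+1] makes the balls shrink to a point; [l] keeps the image of the whole new ball under
       [iter k A] outside [fil n]. *)
    exists (y', maxn m.+1 l); split=> //=; first by rewrite leq_maxl.
    exists k; split=> // z zy' kz; apply: ky'.
    rewrite -[y'](subKr z) (clB (itL k)); apply: levelB => //.
    exact/lP/(fil_le _ zy')/leq_maxr.
  have [k [x [jk xm kx]]] := hump j m.
  (* If the iterate of [y] is already outside [fil n], the centre stays; otherwise adding the hump
     [x] moves its iterate out. *)
  case: (pselect (fil n (iter k A y))) => ky; last first.
    by exists k, y; split=> //; rewrite subrr; apply: level0.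
  exists k, (y + x); split=> //; first by rewrite addrC addKr.
  by rewrite (clD (itL k)) => /levelB/(_ ky); rewrite addrC addKr.
have [f fP] := choice step.
pose s := fix s j := if j is j'.+1 then f (j', s j') else (0 : V, 0%N).
have sS j : s j.+1 = f (j, s j) by [].
have mj j : (j <= (s j).2)%N.
  elim: j => // j IHj; rewrite sS; have [_ + _] := fP (j, s j).
  exact: leq_ltn_trans.
have mono i d : ((s i).2 <= (s (i + d)%N).2)%N.
  elim: d => [|d IHd]; first by rewrite addn0.
  rewrite addnS sS; have [_ /ltnW + _] := fP ((i + d)%N, s (i + d)%N).
  exact: leq_trans.
have near i d : fil (s i).2 ((s (i + d)%N).1 - (s i).1).
  elim: d => [|d IHd]; first by rewrite addn0 subrr; apply: level0.
  rewrite addnS -(subrKA (s (i + d)%N).1) addrC; apply: levelD => //.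
  rewrite sS; have [h _ _] := fP ((i + d)%N, s (i + d)%N).
  exact: fil_le (mono i d) h.
have [|z zP] := fil_complete (fun j => (s j).1).
  move=> j; rewrite sS; have [h _ _] := fP (j, s j).
  exact: fil_le (mj j) h.
have zs i : fil (s i).2 (z - (s i).1).
  rewrite -(subrKA (s (i + (s i).2)%N).1); apply: levelD => //.
  by apply: fil_le (zP _); apply: leq_addl.
have [N NP] := A_vanishing z n.
rewrite /= in NP; have [_ _ [k [Nk kP]]] := fP (N, s N).
by apply: (kP z) => //; [exact: (zs N.+1) | exact: NP].
Qed.

End UniformBoundedness.

(** Equicontinuity is part of the notion so that it is stable under completed tensor products: see
    [expmap_tensor]. *)
Definition expmap (V : cfiltType) (A E : V -> V) :=
  [/\ continuous_linear A, continuous_linear E, equicontinuous_iterates A &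
      exp_converges_to A E].

Definition divpow (V : cfiltType) (A : V -> V) k x := (k`!%:R)^-1 *: iter k A x.

Section Expmap.
Variables (V : cfiltType) (A E : V -> V).

(** The levels are stable under multiplication by k!, so the denominators of the exponential series
    can be cleared. *)
Lemma iter_vanishing :
  exp_converges_to A E -> forall x, vanishing (fun k => iter k A x).
Proof.
move=> hE x; have ve : vanishing (fun k => divpow A k x) := series_vanishing (hE x).
move=> n; have [N NP] := ve n; exists N => k /NP /(levelZ (k`!%:R)).
by rewrite scalerA divff ?fact_neq0 // scale1r.
Qed.

Lemma expmapI : continuous_linear A -> continuous_linear E ->
  exp_converges_to A E -> expmap A E.
Proof.
by move=> hA hE AE; split=> //; apply/iterates_equicontinuous/iter_vanishing.
Qed.

Lemma divpowS k x : continuous_linear A ->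
  k.+1%:R *: divpow A k.+1 x = A (divpow A k x).
Proof.
move=> hA; rewrite /divpow (clZ hA) /= scalerA factS natrM invfM mulrA divff ?mul1r //.
by rewrite Num.Theory.pnatr_eq0.
Qed.

Hypothesis AE : expmap A E.

(* [l] is the value at [x] of the operator (e^A - 1) / A. *)
Lemma expmap_quotient x : exists2 l, A l = E x - x &
  forall (W : cfiltType) (F : V -> W), continuous_linear F ->
    (forall k, F (iter k A x) = 0) -> F l = 0.
Proof.
have [hA hE _ hAE] := AE.
have va : vanishing (fun k => (k.+1`!%:R)^-1 *: iter k A x).
  move=> n; have [N NP] := iter_vanishing hAE x n.
  by exists N => k /NP; apply: levelZ.
have [l lP] := vanishing_series va; exists l => [|W F hF Fk].
  apply: converges_unique (cl_converges hA lP) _ => n.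
  have [N NP] := hAE x n; exists N => k Nk.
  (* Applying [A] to the first [k] terms of [l] gives the first [k.+1] terms of the exponential
     series, less the initial term [x]. *)
  rewrite (cl_sum hA) (_ : \sum_(i < k) _ = \sum_(i < k.+1) divpow A i x - x).
    by rewrite opprB addrA subrK; apply: NP; apply: leqW.
  rewrite big_ord_recl {1}/divpow fact0 invr1 scale1r /= addrC addKr.
  by apply: eq_bigr => i _; rewrite (clZ hA).
apply: converges_unique (cl_converges hF lP) _ => n; exists 0%N => k _.
rewrite (cl_sum hF) big1 ?subrr => [|i _]; first exact: level0.
by rewrite (clZ hF) Fk scaler0.
Qed.

Lemma expmap_comm (W : cfiltType) (A' E' : W -> W) (F : V -> W) x :
  expmap A' E' -> continuous_linear F -> (forall y, F (A y) = A' (F y)) ->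
  F (E x) = E' (F x).
Proof.
move=> [_ _ _ hAE'] hF FA; have [_ _ _ hAE] := AE.
apply: converges_unique (cl_converges hF (hAE x)) _ => n.
have [N NP] := hAE' (F x) n; exists N => k Nk; rewrite (cl_sum hF).
rewrite (eq_bigr (fun i : 'I_k => (i`!%:R)^-1 *: iter i A' (F x))) => [|i _].
  exact: NP.
rewrite (clZ hF); congr (_ *: _).
by elim: (nat_of_ord i) => //= j <-.
Qed.

End Expmap.

Lemma expmap0 (V : cfiltType) : expmap (fun _ : V => 0) id.
Proof.
split; [exact: cl_zero | exact: cl_id | |].
  by move=> n; exists n => -[|k] x xn //=; apply: level0.
move=> x n; exists 1%N => -[//|k] _; rewrite big_ord_recl big1 => [|i _].
  by rewrite fact0 invr1 scale1r addr0 subrr; apply: level0.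
by rewrite lift0 /= scaler0.
Qed.

(** * The exponential of A ⊗ 1 + 1 ⊗ B *)

Section ExpTensor.
Variables (V W : cfiltType) (A E : V -> V) (B T : W -> W).
Hypotheses (AE : expmap A E) (BT : expmap B T).

Let A_cl : continuous_linear A. Proof. by case: AE. Qed.
Let B_cl : continuous_linear B. Proof. by case: BT. Qed.
Let E_cl : continuous_linear E. Proof. by case: AE. Qed.
Let T_cl : continuous_linear T. Proof. by case: BT. Qed.

Definition sumder : V ⊗ W -> V ⊗ W := bilift (fun v w => A v ⊗ w + v ⊗ B w).

Lemma sumder_bb : bounded_bilinear (fun v w => A v ⊗ w + v ⊗ B w).
Proof.
apply: bb_add; first exact: bb_comp (pure_bb V W) A_cl (cl_id _) (cl_id _).
exact: bb_comp (pure_bb V W) (cl_id _) B_cl (cl_id _).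
Qed.

Lemma sumder_cl : continuous_linear sumder.
Proof. exact: bilift_cl sumder_bb. Qed.

Lemma sumder_pure v w : sumder (v ⊗ w) = A v ⊗ w + v ⊗ B w.
Proof. exact: bilift_pure sumder_bb v w. Qed.

(** Divided powers free the Leibniz rule from binomial coefficients. After multiplication by k + 1,
    the two halves of [sumder] contribute the weights i and k + 1 - i to the term of index i. *)
Lemma divpow_pure k v w : divpow sumder k (v ⊗ w) =
  \sum_(i < k.+1) divpow A i v ⊗ divpow B (k - i) w.
Proof.
have nz j : (j.+1%:R : rat) != 0 by rewrite Num.Theory.pnatr_eq0.
elim: k => [|k IHk].
  by rewrite big_ord_recl big_ord0 addr0 /divpow !fact0 !invr1 !scale1r.
apply: (scalerI (nz k)); rewrite divpowS; last exact: sumder_cl.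
rewrite IHk (cl_sum sumder_cl).
under eq_bigr => i _ do rewrite sumder_pure -!divpowS //.
rewrite big_split /=.
under [X in _ + X]eq_bigr => i _ do rewrite (clZ (pure_cl _ _)) -subSn -1?ltnS //.
under eq_bigr => i _ do rewrite (clZ (pure_cll V _)).
pose F (i : nat) := divpow A i v ⊗ divpow B (k.+1 - i) w.
have -> : \sum_(i < k.+1) i.+1%:R *: (divpow A i.+1 v ⊗ divpow B (k - i) w) =
    \sum_(i < k.+2) i%:R *: F i.
  by rewrite [RHS]big_ord_recl scale0r add0r.
have -> : \sum_(i < k.+1) (k.+1 - i)%:R *: (divpow A i v ⊗ divpow B (k.+1 - i) w) =
    \sum_(i < k.+2) (k.+1 - i)%:R *: F i.
  by rewrite [RHS]big_ord_recr /= subnn scale0r addr0.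
rewrite -big_split scaler_sumr; apply: eq_bigr => i _ /=.
by rewrite -scalerDl -natrD subnKC // -ltnS.
Qed.

Lemma divpow_fil n k v w : (forall i, fil n (divpow A i v)) \/
  (forall i, fil n (divpow B i w)) -> fil n (divpow sumder k (v ⊗ w)).
Proof.
move=> h; rewrite divpow_pure; apply: fil_sum => i _.
by apply: pure_fil; case: h => h; [left | right].
Qed.

(** By the Leibniz rule, the iterates of [sumder] at a pure tensor are small as soon as all iterates
    at one of its factors are. The resulting modulus is uniform in [k], and [bilift_fil] carries it
    to all tensors. *)
Lemma sumder_equicontinuous : equicontinuous_iterates sumder.
Proof.
move=> n; have [_ _ /(_ n)[m1 h1] _] := AE; have [_ _ /(_ n)[m2 h2] _] := BT.
exists (maxn m1 m2) => k t tn.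
have kcl := cl_iter k sumder_cl.
have kbb : bounded_bilinear (fun v w => iter k sumder (v ⊗ w)).
  exact: bb_comp (pure_bb V W) (cl_id _) (cl_id _) kcl.
have -> : iter k sumder t = bilift (fun v w => iter k sumder (v ⊗ w)) t.
  move: t {tn}; apply: tensor_eq => [||v w]; [exact: kcl | exact: bilift_cl |].
  by rewrite bilift_pure.
apply: bilift_fil tn => // v w vw.
rewrite -[iter _ _ _]scale1r -(@divff _ k`!%:R) ?fact_neq0 // -scalerA.
apply/levelZ/divpow_fil; case: vw => h; [left | right] => i; apply: levelZ.
  exact/h1/(fil_le _ h)/leq_maxl.
exact/h2/(fil_le _ h)/leq_maxr.
Qed.

Lemma sum_divpow_pure N v w : \sum_(k < N) divpow sumder k (v ⊗ w) =
  \sum_(i < N) divpow A i v ⊗ \sum_(j < N - i) divpow B j w.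
Proof.
elim: N => [|N IHN]; first by rewrite !big_ord0.
rewrite [LHS]big_ord_recr /= IHN divpow_pure.
under [RHS]eq_bigr => i _ do rewrite subSn -1?ltnS // big_ord_recr (clD (pure_cl _ _)).
rewrite big_split /=; congr (_ + _).
by rewrite [RHS]big_ord_recr /= subnn big_ord0 (cl0 (pure_cl _ _)) addr0.
Qed.

Lemma exp_pure v w : converges (fun n => \sum_(k < n) divpow sumder k (v ⊗ w))
  (E v ⊗ T w).
Proof.
move=> n; have [_ _ _ /(_ v) hA] := AE; have [_ _ _ /(_ w) hB] := BT.
have va : vanishing (fun k => divpow A k v) := series_vanishing hA.
have [N0 h0] := va n; have [N1 h1] := hA n; have [N2 h2] := hB n.
exists (N0 + N1 + N2)%N => N hN; rewrite sum_divpow_pure.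
rewrite -(subrKA (\sum_(i < N) divpow A i v ⊗ T w)); apply: levelD.
  rewrite -sumrB; apply: fil_sum => i _; rewrite -(clB (pure_cl _ _)).
  (* For [i] beyond [N0] the left factor is small; for the other [i], at least [N2] terms remain in
     the inner sum, which is then close to [T w]. *)
  apply: pure_fil; case: (leqP N0 i) => iN; first by left; apply: h0.
  by right; apply: h2; lia.
rewrite -(cl_sum (pure_cll V (T w))) -(clB (pure_cll V _)).
by apply: pure_fil; left; apply: h1; lia.
Qed.

(** Convergence on finite sums of pure tensors, which are dense, extends to all [t]: equicontinuity
    bounds the contribution of the error [t - x] independently of the number of terms. *)
Lemma expmap_tensor : expmap sumder (tmap E T).
Proof.
have tcl := tmap_cl E_cl T_cl; have dcl := sumder_cl.
split=> //; first exact: sumder_equicontinuous.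
move=> t n; have [m mP] := sumder_equicontinuous n.
have [l lP] := tcl.2 n.
have t0 : fil 0 t by rewrite level_full.
have [x xP tx] := tensor_dense (leq0n (maxn m l)) t0.
have [N NP] : exists N, forall k, (N <= k)%N ->
    fil n (\sum_(i < k) divpow sumder i x - tmap E T x).
  elim: xP => [|a _ y [v [w [_ ->]]] _ [N NP]].
    exists 0%N => k _; rewrite (cl0 tcl) subr0; apply: fil_sum => i _.
    by apply: levelZ; rewrite (cl0 (cl_iter _ dcl)); apply: level0.
  have [N1 NP1] := exp_pure v w n; exists (maxn N N1) => k.
  rewrite geq_max => /andP[/NP h /NP1 h1].
  rewrite (clP tcl) (tmap_pure E_cl T_cl).
  have -> : \sum_(i < k) divpow sumder i (a *: (v ⊗ w) + y) =
      a *: (\sum_(i < k) divpow sumder i (v ⊗ w)) + \sum_(i < k) divpow sumder i y.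
    rewrite scaler_sumr -big_split; apply: eq_bigr => i _ /=.
    by rewrite /divpow (clP (cl_iter i dcl)) scalerDr !scalerA mulrC.
  by rewrite opprD addrACA -scalerBr; apply: level_lin.
exists N => k /NP h.
have -> : t = x + (t - x) by rewrite addrC subrK.
rewrite (clD tcl) [X in fil n (X - _)](_ : _ =
    \sum_(i < k) divpow sumder i x + \sum_(i < k) divpow sumder i (t - x)).
  rewrite opprD addrACA; apply: levelD => //; apply: levelB.
    by apply: fil_sum => i _; apply/levelZ/mP/(fil_le _ tx)/leq_maxl.
  exact/lP/(fil_le _ tx)/leq_maxr.
rewrite -big_split; apply: eq_bigr => i _.
by rewrite (clD (cl_iter i dcl)) scalerDr.
Qed.

End ExpTensor.

(** * Exponentials and homology *)

Lemma expmap_tpow (g : cfiltType) (A E : g -> g) p :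
  expmap A E -> expmap (@tder g A p) (@tpmap g E p).
Proof.
move=> AE; have [hA hE _ _] := AE.
(* From degree 2 on, [tder] and [tpmap] unfold to [sumder] and [tmap]; degree 1 is [g] itself. *)
elim: p => [|[|p] IHp]; [exact: expmap0 | | exact: expmap_tensor].
have -> : @tder g A 1 = A; last by rewrite tpmap1.
apply: funext => x; have := tder_tcons hA x (1 : tpow g 0).
by rewrite tder0 (cl0 (tcons_cl x)) addr0 /tcons !scale1r.
Qed.

Section Transport.
Variables (g M : cfiltType) (nabla : g ⊗ g -> g) (act : g ⊗ M -> M).
Hypotheses (hg : is_lie_algebra nabla) (hM : is_module g M nabla act).
Variables (X : g) (U : top_aut g) (UM : top_aut M).
Hypotheses (hU : exp_converges_to (ad nabla X) U)
  (hUM : exp_converges_to (sigmaM act X) UM).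
Local Notation bd := (boundaryM g M nabla act).
Local Notation E := (@mmap g U M UM _).
Local Notation EV := (@mmap g (autV U) M (autV UM) _).

Lemma expmap_chains p : expmap (@mder g M nabla act X p) (@mmap g U M UM p).
Proof.
apply: (@expmap_tensor _ _ (sigmaM act X) UM).
  by apply: expmapI => //; [exact: bb_clr (act_bb hM) X | exact: aut_cl].
by apply/expmap_tpow/expmapI => //; [exact: ad_cl | exact: aut_cl].
Qed.

Let E_cl {p} : continuous_linear (@mmap g U M UM p).
Proof. exact (mmap_cl (aut_cl U) (aut_cl UM)). Qed.

Let EV_cl {p} : continuous_linear (@mmap g (autV U) M (autV UM) p).
Proof. exact (mmap_cl (autV_cl U) (autV_cl UM)). Qed.

Lemma tpmap_can (f h : g -> g) p : continuous_linear f -> continuous_linear h ->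
  cancel f h -> cancel (@tpmap g f p) (@tpmap g h p).
Proof.
move=> hf hh fK; elim: p => [//|p IHp]; apply: tpow_ext => [||x t].
- exact: cl_comp (tpmap_cl hf) (tpmap_cl hh).
- exact: cl_id.
by rewrite !tpmap_tcons // fK IHp.
Qed.

Lemma mmap_EVK p (u : M ⊗ tpow g p) : E (EV u) = u.
Proof.
move: u; apply: tensor_eq => [||m t]; [exact: cl_comp EV_cl E_cl | exact: cl_id |].
rewrite !mmap_pure; try exact: aut_cl; try exact: autV_cl.
by rewrite autVK tpmap_can //; [exact: autV_cl | exact: aut_cl | exact: autVK].
Qed.

Lemma mmap_EK p (u : M ⊗ tpow g p) : EV (E u) = u.
Proof.
move: u; apply: tensor_eq => [||m t]; [exact: cl_comp E_cl EV_cl | exact: cl_id |].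
rewrite !mmap_pure; try exact: aut_cl; try exact: autV_cl.
by rewrite autK tpmap_can //; [exact: aut_cl | exact: autV_cl | exact: autK].
Qed.

Lemma mmap_boundaryM p (u : M ⊗ tpow g p) : E (bd p u) = bd p (E u).
Proof.
symmetry; apply: (expmap_comm (F := bd p) (expmap_chains p) u (expmap_chains p.-1)).
  exact: boundaryM_cl.
by move=> v; rewrite mder_boundaryM.
Qed.

Lemma mmap_malt p (u : M ⊗ tpow g p) : E (malt u) = malt (E u).
Proof.
symmetry; apply: (expmap_comm (F := @malt g M p) (expmap_chains p) u (expmap_chains p)).
  exact: malt_cl.
by move=> v; rewrite mder_malt.
Qed.

Local Notation cycles := (cycles g M nabla act).
Local Notation boundaries := (boundaries g M nabla act).

Lemma cycles_mmap p (u : M ⊗ tpow g p) : cycles p u -> cycles p (E u).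
Proof.
case=> /chainsP uc bu; split; last by rewrite -mmap_boundaryM bu (cl0 E_cl).
by apply/chainsP; rewrite -mmap_malt uc.
Qed.

Let E_inj p : injective (@mmap g U M UM p) := can_inj (@mmap_EK p).

(** Transferred from [E] by injectivity; the inverse is never expanded as a series. *)
Lemma mmapV_boundaryM p (u : M ⊗ tpow g p) : EV (bd p u) = bd p (EV u).
Proof. by apply: E_inj; rewrite mmap_boundaryM !mmap_EVK. Qed.

Lemma mmapV_malt p (u : M ⊗ tpow g p) : EV (malt u) = malt (EV u).
Proof. by apply: E_inj; rewrite mmap_malt !mmap_EVK. Qed.

Lemma cycles_mmapV p (u : M ⊗ tpow g p) : cycles p u -> cycles p (EV u).
Proof.
case=> /chainsP uc bu; split; last by rewrite -mmapV_boundaryM bu (cl0 EV_cl).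
by apply/chainsP; rewrite -mmapV_malt uc.
Qed.

Lemma boundariesD p u v : boundaries p u -> boundaries p v -> boundaries p (u + v).
Proof.
have bcl := boundaryM_cl hg hM p.+1.
case=> w /chainsP wc <- [z /chainsP zc <-]; exists (w + z); last exact: (clD bcl).
by apply/chainsP; rewrite (clD malt_cl) wc zc.
Qed.

Lemma boundariesN p u : boundaries p u -> boundaries p (- u).
Proof.
have bcl := boundaryM_cl hg hM p.+1.
case=> w /chainsP wc <-; exists (- w); last exact: (clN bcl).
by apply/chainsP; rewrite (clN malt_cl) wc.
Qed.

Lemma boundariesB p u v : boundaries p u -> boundaries p v -> boundaries p (u - v).
Proof. by move=> uB /boundariesN; apply: boundariesD. Qed.

Lemma boundaries_mmap p u : boundaries p u -> boundaries p (E u).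
Proof.
case=> w /chainsP wc <-; exists (E w); last exact: esym (@mmap_boundaryM p.+1 w).
by apply/chainsP; rewrite -mmap_malt wc.
Qed.

Lemma boundaries_mmapV p u : boundaries p u -> boundaries p (EV u).
Proof.
case=> w /chainsP wc <-; exists (EV w); last exact: esym (@mmapV_boundaryM p.+1 w).
by apply/chainsP; rewrite -mmapV_malt wc.
Qed.

Lemma boundaries_exp p (u : M ⊗ tpow g p) : cycles p u -> boundaries p (E u - u).
Proof.
case=> /chainsP uc bu; have [l Dl lP] := expmap_quotient (expmap_chains p) u.
(* [l] inherits from [u] any linear condition given by a continuous map that commutes with the
   derivation. This is applied to being alternating and to being a cycle. *)
have iter0 q (F : M ⊗ tpow g p -> M ⊗ tpow g q) : continuous_linear F ->
    F u = 0 -> (forall v, F (mder nabla act X v) = mder nabla act X (F v)) ->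
    F l = 0.
  move=> Fcl Fu FD; apply: lP => // k.
  have -> : F (iter k (@mder g M nabla act X _) u) =
      iter k (@mder g M nabla act X _) (F u).
    by elim: k => //= k <-.
  by rewrite Fu; apply: (cl0 (cl_iter _ (mder_cl hg hM X))).
have lc : malt l = l.
  apply/eqP; rewrite -subr_eq0; apply/eqP.
  apply: (iter0 p (fun v => malt v - v)).
  - exact: cl_sub malt_cl (cl_id _).
  - by rewrite uc subrr.
  by move=> v; rewrite (clB (mder_cl hg hM X)) mder_malt.
have bl : bd p l = 0.
  by apply: iter0 => // [|v]; [exact: boundaryM_cl | rewrite mder_boundaryM].
(* By Cartan's formula, wedging [l] with [X] has boundary [- mder l], that is, the opposite of E u -
   u; hence [- l]. *)
exists (mshuf X (- l)); last first.
  rewrite (clN (mshuf_cl M X)) (clN (boundaryM_cl hg hM _)).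
  by rewrite boundaryM_homotopy // opprK.
by apply/chainsP; rewrite -lc -(clN malt_cl) malt_mshuf.
Qed.

End Transport.

Theorem lemma3p2p2 (g M : cfiltType)
    (nabla : g ⊗ g -> g) (delta : g -> g ⊗ g)
    (act : g ⊗ M -> M) (mu : M -> M ⊗ g)
    (hg : is_involutive_lie_bialgebra nabla delta)
    (hM : is_involutive_bimodule nabla act delta mu)
    (X : g) (U : top_aut g) (UM : top_aut M)
    (hU : exp_converges_to (ad nabla X) U)
    (hUlie : lie_morphism nabla U)
    (hUM : exp_converges_to (sigmaM act X) UM) :
  forall (p : nat) (c : set (M ⊗ tpow g p)), homology nabla act p c ->
    codiff_homology nabla act delta mu p c =
    codiff_homology nabla act (transport_delta U delta)
      (transport_mu U UM mu) p c.
Proof.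
case: hg hM => lg dcl _ _ _ _ [mg mcl _ _ _] p _ [u0 u0c <-].
have d'cl : continuous_linear (transport_delta U delta).
  exact: cl_comp (cl_comp (autV_cl U) dcl) (tmap_cl (aut_cl U) (aut_cl U)).
have m'cl : continuous_linear (transport_mu U UM mu).
  exact: cl_comp (cl_comp (autV_cl UM) mcl) (tmap_cl (aut_cl UM) (aut_cl U)).
pose E q := @mmap g U M UM q.
have Ecl q : continuous_linear (E q) by apply: mmap_cl; exact: aut_cl.
have Ed u : E p.+1 (codiffM g M delta mu p u) =
    codiffM g M (transport_delta U delta) (transport_mu U UM mu) p (E p u).
  apply: (mmap_codiffM (aut_cl U)) => //.
    by move=> x; rewrite /transport_delta autK.
    exact: aut_cl.
  by move=> m; rewrite /transport_mu autK.
have Eexp := boundaries_exp lg mg hU hUM.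
have D q := @boundariesD g M nabla act lg mg q.
have B q := @boundariesB g M nabla act lg mg q.
apply/seteqP; split=> w [u [uc uu0] [wc wdu]].
- exists (E p u).
    split; first exact: (cycles_mmap lg mg hU hUM).
    by rewrite -(subrKA u); apply: D => //; apply: Eexp.
  split=> //; rewrite -Ed.
  (* [w] is itself a cycle, so it may be exchanged for E w, which differs from the transported
     codifferential of E u by the image under E of a boundary. *)
  have -> : w - E _ (codiffM g M delta mu p u) =
      E _ (w - codiffM g M delta mu p u) - (E _ w - w).
    by rewrite (clB (Ecl _)) opprB [RHS]addrC subrKA.
  by apply: B; [exact: (boundaries_mmap lg mg hU hUM) | exact: Eexp].
(* Conversely, everything is pulled back by the inverse of E: [v] replaces [u], and the preimage of
   [w] differs from [w] by a boundary. *)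
pose v := @mmap g (autV U) M (autV UM) p u.
have vc : cycles g M nabla act p v by exact: (cycles_mmapV lg mg hU hUM).
have Ev : E p v = u by exact: mmap_EVK.
exists v.
  split=> //; have -> : v - u0 = u - u0 - (E p v - v).
    by rewrite Ev opprB [RHS]addrC subrKA.
  by apply: B => //; apply: Eexp.
split=> //; have Vw := boundaries_mmapV lg mg hU hUM wdu.
rewrite -Ev -Ed (clB (mmap_cl (autV_cl U) (autV_cl UM))) mmap_EK in Vw.
have := D _ _ _ (Eexp _ _ (cycles_mmapV lg mg hU hUM wc)) Vw.
by rewrite mmap_EVK subrKA.
Qed.
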